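(* Let $r\ge3$, $\boldsymbol d=(2,\ldots,2,1)\in\mathbb{Z}^r$, and let $A=(A_{ij})$ be the $r\times r$ matrix with $A_{11}=1$, $A_{1r}=1$, $A_{r1}=\frac12$, $A_{1j}=A_{j1}=0$ for $2\le j\le r-1$, $A_{ij}=2(\min(i,j)-1)$ for $2\le i\le r-1$, $2\le j\le r$, and $A_{rj}=j-1$ for $2\le j\le r$. Put $$\boldsymbol b_{r+1}=(0,\ldots,0,1)^T,\quad c_{r+1}=\frac{37-4r}{32r-8},\qquad \widetilde{\boldsymbol b}_{r+1}=(1,2,4,\ldots,2(r-2),r)^T,\quad \widetilde c_{r+1}=\frac{(4r-7)^2}{32r-8}$$ (so $\widetilde{\boldsymbol b}_{r+1}$ has first entry $1$, $i$-th entry $2(i-1)$ for $2\le i\le r-1$, and last entry $r$). Then, with $$g_2(\tau)=q^{\frac{(4r-7)^2}{32r-8}}\left(q^{\frac{3-r}2}\frac{(q^{8r-8},q^{8r+4},q^{16r-4};q^{16r-4})_\infty}{(q,q^3,q^4;q^4)_\infty}+\frac{(-q^3,q^{4r-4},-q^{4r-1};-q^{4r-1})_\infty}{(q^2,q^2,q^4;q^4)_\infty}\right),$$ one has $$g_2(\tau)=\widetilde f_{A,\boldsymbol b_{r+1},c_{r+1},\boldsymbol d}(\tau)+\widetilde f_{A,\widetilde{\boldsymbol b}_{r+1},\widetilde c_{r+1},\boldsymbol d}(\tau).$$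
   Context: Notation: $\mathrm{Im}\,\tau>0$, $q=e^{2\pi i\tau}$, $q^x=e^{2\pi ix\tau}$ for rational $x$; $(a;p)_\infty=\prod_{n\ge0}(1-ap^n)$, $(a;p)_n=\prod_{k=0}^{n-1}(1-ap^k)$, $(a_1,\ldots,a_k;p)_\infty=\prod_i(a_i;p)_\infty$. For $\boldsymbol d=(d_1,\ldots,d_r)\in\mathbb{Z}_{>0}^r$, $D=\mathrm{diag}(d_1,\ldots,d_r)$, $A\in\mathbb{Q}^{r\times r}$ with $AD$ symmetric positive definite, $\boldsymbol b\in\mathbb{Q}^r$, $c\in\mathbb{Q}$, the generalized Nahm sum is $$\widetilde f_{A,\boldsymbol b,c,\boldsymbol d}(\tau)=\widetilde f_{A,\boldsymbol b,c,\boldsymbol d}(q)=\sum_{\boldsymbol n\in\mathbb{N}^r}\frac{q^{\frac12\boldsymbol n^TAD\boldsymbol n+\boldsymbol n^T\boldsymbol b+c}}{(q^{d_1};q^{d_1})_{n_1}\cdots(q^{d_r};q^{d_r})_{n_r}},\qquad \mathbb{N}=\{0,1,2,\ldots\}.$$ *)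

(* Defs.v *)
From HB Require Import structures.
From mathcomp Require Import all_boot all_order all_algebra.
From mathcomp Require Import complex.
From mathcomp Require Import all_classical all_reals all_analysis.
From mathcomp Require Import summability.
Import Order.TTheory GRing.Theory Num.Theory.
Import numFieldNormedType.Exports.

Set Implicit Arguments.
Unset Strict Implicit.
Unset Printing Implicit Defensive.

Local Open Scope classical_set_scope.
Local Open Scope ring_scope.
Local Open Scope complex_scope.

Definition cexp (R : realType) (z : R[i]) : R[i] :=
  (expR (complex.Re z))%:C * (cos (complex.Im z) +i* sin (complex.Im z)).

(* q^x is exp(2 pi i x tau), a function of tau rather than of the complex number
   q = exp(2 pi i tau), so fractional x involve no choice of branch. *)
Definition qpow (R : realType) (tau : R[i]) (x : rat) : R[i] :=
  cexp ((2 * pi)%:C * 'i%C * ratr x * tau).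

Definition qpoch (R : realType) (a p : R[i]) (n : nat) : R[i] :=
  \prod_(k < n) (1 - a * p ^+ k).

(* The limit exists whenever |p| < 1. *)
Definition qpoch_inf (R : realType) (a p : R[i]) : R[i] :=
  lim ((qpoch a p : nat -> R[i]^o) @ \oo).

Definition qpochs_inf (R : realType) (s : seq R[i]) (p : R[i]) : R[i] :=
  \prod_(a <- s) qpoch_inf a p.

Section NahmSum.
Variables (R : realType) (r : nat).
Variables (A : 'M[rat]_r) (b : 'cV[rat]_r) (c : rat) (d : 'cV[nat]_r).

Definition nahm_exponent (n : 'cV[nat]_r) : rat :=
  let v : 'cV[rat]_r := map_mx (fun k : nat => k%:R) n in
  let D : 'M[rat]_r := diag_mx (\row_i (d i 0)%:R) in
  (2^-1 *: (v^T *m (A *m D) *m v) + v^T *m b) 0 0 + c.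

Definition nahm_term (tau : R[i]) (n : 'cV[nat]_r) : R[i] :=
  qpow tau (nahm_exponent n) /
  \prod_i qpoch (qpow tau (d i 0)%:R) (qpow tau (d i 0)%:R) (n i 0).

(* Unordered sum over N^r: the limit of the partial sums along the filter of
   finite subsets of N^r ordered by inclusion. It converges (absolutely) when
   0 < Im tau, the d_i are positive and A D is symmetric positive definite. *)
Definition nahm_sum (tau : R[i]) : R[i] :=
  summability.sum (nahm_term tau : 'cV[nat]_r -> R[i]^o).

End NahmSum.

(* A_entry and bt_entry take 1-based indices, whence the i.+1, j.+1 below. *)
Definition A_entry (r i j : nat) : rat :=
  if i == 1%N then (if (j == 1%N) || (j == r) then 1 else 0)
  else if j == 1%N then (if i == r then 2^-1 else 0)
  else if i == r then j%:R - 1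
  else 2 * ((minn i j)%:R - 1).

Definition nahmA (r : nat) : 'M[rat]_r := \matrix_(i, j) A_entry r i.+1 j.+1.

Definition nahm_d (r : nat) : 'cV[nat]_r :=
  \col_i (if i.+1 == r then 1%N else 2%N).

Definition nahm_b (r : nat) : 'cV[rat]_r :=
  \col_i (if i.+1 == r then 1 else 0).

Definition nahm_c (r : nat) : rat := (37 - 4 * r%:R) / (32 * r%:R - 8).

Definition bt_entry (r i : nat) : rat :=
  if i == 1%N then 1 else if i == r then r%:R else 2 * (i%:R - 1).

Definition nahm_bt (r : nat) : 'cV[rat]_r := \col_i bt_entry r i.+1.

Definition nahm_ct (r : nat) : rat := (4 * r%:R - 7) ^+ 2 / (32 * r%:R - 8).

Definition g2 (R : realType) (r : nat) (tau : R[i]) : R[i] :=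
  let q := qpow tau in
  let N : rat := r%:R in
  q ((4 * N - 7) ^+ 2 / (32 * N - 8)) *
  (q ((3 - N) / 2) *
     (qpochs_inf [:: q (8 * N - 8); q (8 * N + 4); q (16 * N - 4)]
                 (q (16 * N - 4))
      / qpochs_inf [:: q 1; q 3; q 4] (q 4))
   + qpochs_inf [:: - q 3; q (4 * N - 4); - q (4 * N - 1)] (- q (4 * N - 1))
     / qpochs_inf [:: q 2; q 2; q 4] (q 4)).

(* Main.v *)
(** For fixed n_2, ..., n_r the sum over n_1 is Euler's expansion of
    (-q^(1+n_r); q^2)_oo.  The general term of the second series, written in terms of
    e = n_r + 1, is that of the first one at n_r = e multiplied by q^-2 (1 - q^e), so the
    two series merge into a single one over e.  Splitting it by the parity s of
    e = 2 m + s and putting Q = q^2, each half is a Bailey chain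
      sum Q^(M_2^2 + ... + M_(r-1)^2 + m^2 + s (M_2 + ... + M_(r-1) + m)) beta_m
        / ((Q;Q)_(M_2-M_3) ... (Q;Q)_(M_(r-1)-m)),
    where beta_m = sum_j theta_j / ((Q;Q)_(m-dj) (Q;Q)_(m+s+dj)), d = 2 - s, and theta_j is
    (-1)^j q^(6j(j-1)) for s = 0 and (-1)^(j(j+1)/2) q^(3j(j-1)/2) for s = 1.  Iterating
    Bailey's lemma and letting the length go to infinity turns each half into a theta
    series, which the Jacobi triple product evaluates. *)

Require Import Defs.
From mathcomp Require Import all_boot all_order all_algebra.
From mathcomp Require Import complex finmap.
From mathcomp Require Import all_classical all_reals all_analysis.
From mathcomp Require Import summability.
From mathcomp Require Import ring lra zify.
Import Order.TTheory GRing.Theory Num.Theory.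
Import numFieldNormedType.Exports.
Set Implicit Arguments.
Unset Strict Implicit.
Unset Printing Implicit Defensive.
Local Open Scope classical_set_scope.
Local Open Scope fset_scope.
Local Open Scope ring_scope.
Local Open Scope complex_scope.

(** * Unordered sums *)

(** With [N_i = n_i + ... + n_(r-1)], half the quadratic form is [n_1^2 + n_1 n_r + n_r^2/2 + (1/2)
    sum_i (2 N_i + n_r)^2]. For [n_r = 2m + s] and [M_i = N_i + m] the squares become
    [(2 M_i + s)^2]; this is why the parity must be fixed and where the exponents [s M_i] come from.
    The real obstacle is a closed form for [beta_m]. Put [x = Q^(d j)] and weight the kernel by
    [theta_j], [theta_j x] or [theta_j x^2]. The symmetries of [theta_j] under [j -> 1 - j] and
    [j -> -j - s] express the first and third sums through the middle one, which therefore obeys a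
    first-order recurrence in [m] and is a product. The first sum is [beta_m], and its ratio to the
    middle one is, up to a power of [q], exactly the factor [1 + q^-2 (1 - q^e)] created by merging
    the two series. The sum over the outermost [M_2] has no factor [1/(Q;Q)_(N-M_2)]: it is the
    limit [N -> oo] of one further Bailey step. Hence [r - 2] gap variables produce [r - 1] in the
    theta exponents. *)

Section HasSum.
Variable R : realType.
Local Notation C := R[i].

(** The tolerance lives in [C], where [0 < e] already forces [e] to be real; norms in [C] can then
    be compared with it directly. *)
Definition has_sum (I : choiceType) (f : I -> C) (l : C) :=
  forall e : C, 0 < e -> exists A : {fset I}, forall B : {fset I},
    A `<=` B -> `|l - \sum_(i <- B) f i| < e.

Definition tends_to (u : nat -> C) (l : C) :=
  forall e : C, 0 < e -> exists N, forall n, (N <= n)%N -> `|l - u n| < e.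

Definition abs_summable (I : choiceType) (f : I -> C) :=
  exists B : C, forall A : {fset I}, \sum_(i <- A) `|f i| <= B.

Lemma tends_toP (u : nat -> C) (l : C) :
  tends_to u l <-> (u : nat -> C^o) @ \oo --> (l : C^o).
Proof.
split=> h.
  apply/(@cvgrPdist_lt C C^o) => e /h[N hN]; exists N => // n Nn; exact: hN.
move=> e e0; move/(@cvgrPdist_lt C C^o) : h => /(_ e e0)[N _ hN].
by exists N => n Nn; exact: hN.
Qed.

Lemma has_sum_lim (I : choiceType) (f : I -> C) (l : C) :
  has_sum f l -> summability.sum (f : I -> C^o) = l.
Proof.
move=> h; apply: cvg_lim; [exact: norm_hausdorff | exact: totally_filter |].
have FT : Filter (@totally I) := @filter_filter _ _ (@totally_filter I).
apply/(@cvgrPdist_lt C C^o) => e /h[A hA]; exists A => // B AB.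
by have := hA B AB; rewrite /partial_sum/= big_seq_fsetE.
Qed.

Lemma has_sum_unique (I : choiceType) (f : I -> C) (l l' : C) :
  has_sum f l -> has_sum f l' -> l = l'.
Proof. by move=> /has_sum_lim <- /has_sum_lim <-. Qed.


Lemma eq_has_sum (I : choiceType) (f g : I -> C) (l : C) :
  f =1 g -> has_sum f l -> has_sum g l.
Proof. by move=> /funext->. Qed.

Lemma has_sumD (I : choiceType) (f g : I -> C) (l l' : C) :
  has_sum f l -> has_sum g l' -> has_sum (fun i => f i + g i) (l + l').
Proof.
move=> hf hg e e0.
have e20 : 0 < e / 2 by rewrite divr_gt0.
have [A hA] := hf _ e20; have [A' hA'] := hg _ e20.
exists (A `|` A') => B; rewrite fsubUset => /andP[AB A'B].
rewrite big_split/= opprD addrACA [e]splitr (le_lt_trans (ler_normD _ _))//.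
by rewrite ltrD ?hA ?hA'.
Qed.

Arguments has_sumD {I f g l l'}.
Lemma has_sumZ (I : choiceType) (c : C) (f : I -> C) (l : C) :
  has_sum f l -> has_sum (fun i => c * f i) (c * l).
Proof.
move=> hf e e0; have c0 : 0 < `|c| + 1 by rewrite ltr_wpDl.
have [A hA] := hf _ (divr_gt0 e0 c0); exists A => B AB.
rewrite -mulr_sumr -mulrBr normrM.
apply: (@le_lt_trans _ _ ((`|c| + 1) * `|l - \sum_(i <- B) f i|)).
  by rewrite ler_wpM2r// lerDl.
by rewrite mulrC -ltr_pdivlMr// hA.
Qed.

Arguments has_sumZ {I} c {f l}.
Lemma has_sum0 (I : choiceType) : has_sum (fun _ : I => 0) 0.
Proof. by move=> e e0; exists fset0 => B _; rewrite big1_eq subrr normr0. Qed.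

Lemma has_sum_finsupp (I : choiceType) (A : {fset I}) (f : I -> C) :
  (forall i, i \notin A -> f i = 0) -> has_sum f (\sum_(i <- A) f i).
Proof.
move=> fA e e0; exists A => B AB.
rewrite (big_fset_incl +%R AB) ?subrr ?normr0// => i _ iA.
exact: fA.
Qed.

Lemma sum_imfset_cancel (I K : choiceType) (phi : K -> I) (g : I -> K)
    (f : I -> C) (B : {fset K}) :
  cancel phi g -> \sum_(i <- phi @` B) f i = \sum_(k <- B) f (phi k).
Proof. by move=> phiK; rewrite big_imfset//= => x y _ _ /(can_inj phiK). Qed.

Lemma sum_preimage_cancel (I K : choiceType) (phi : K -> I) (g : I -> K)
    (f : I -> C) (B : {fset I}) :
  cancel phi g -> (forall i, f i != 0 -> phi (g i) = i) ->
  \sum_(i <- B) f i =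
  \sum_(k <- [fset g i | i in B & phi (g i) == i]) f (phi k).
Proof.
move=> phiK fg; rewrite -(sum_imfset_cancel _ _ phiK).
symmetry; apply: big_fset_incl => [|i iB iC].
  apply/fsubsetP => x /imfsetP[/= k /imfsetP[/= y + ->] ->].
  by rewrite inE => /andP[yB /eqP->].
apply: contraNeq iC => /fg fi; apply/imfsetP; exists (g i) => //=.
by apply/imfsetP; exists i => //=; rewrite inE iB/=; apply/eqP.
Qed.

(** [phi] need not be onto: it suffices that [f] is supported on its image. This covers embeddings
    such as [nat] into [int], a fibre of a map, or a parity class. *)
Lemma has_sum_reindex (I K : choiceType) (phi : K -> I) (g : I -> K)
    (f : I -> C) (l : C) :
  cancel phi g -> (forall i, f i != 0 -> phi (g i) = i) ->
  has_sum (f \o phi) l <-> has_sum f l.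
Proof.
move=> phiK fg.
split=> h e /h[A hA].
  exists (phi @` A) => B AB.
  rewrite (sum_preimage_cancel B phiK fg); apply: hA; apply/fsubsetP => x xA.
  apply/imfsetP => /=; exists (phi x); last by rewrite phiK.
  rewrite inE phiK eqxx andbT; apply: (fsubsetP AB); exact: in_imfset.
exists (g @` A) => B AB; rewrite -(sum_imfset_cancel _ _ phiK).
rewrite -(_ : \sum_(i <- A `|` phi @` B) f i = \sum_(i <- phi @` B) f i).
  by apply: hA; exact: fsubsetUl.
symmetry; apply: big_fset_incl => [|i]; first exact: fsubsetUr.
rewrite !inE => iAB iB; apply: contraNeq iB => /fg fi.
rewrite -fi in_imfset//=; apply: contraLR iAB => giB.
rewrite negb_or; apply/andP; split.
  by apply: contra giB => iA; apply: (fsubsetP AB); exact: in_imfset.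
by apply: contra giB => /imfsetP[k kB ->]; rewrite phiK.
Qed.

Lemma has_sum_sum (I : choiceType) (K : eqType) (s : seq K) (f : K -> I -> C) (l : K -> C) :
  (forall k, k \in s -> has_sum (f k) (l k)) ->
  has_sum (fun i => \sum_(k <- s) f k i) (\sum_(k <- s) l k).
Proof.
elim: s => [|k s IH] h.
  rewrite big_nil; apply: (eq_has_sum _ (has_sum0 I)) => i.
  by rewrite big_nil.
rewrite big_cons (_ : (fun _ => _) = fun i => f k i + \sum_(k <- s) f k i).
  apply: has_sumD; first by apply: h; rewrite inE eqxx.
  by apply: IH => k' k's; apply: h; rewrite inE k's orbT.
by apply/funext => i; rewrite big_cons.
Qed.

(** Each estimate involves only the finitely many fibres over [B], so no uniformity in [k] is
    required of the fibre sums. *)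
Lemma has_sum_fiber (I K : choiceType) (p : I -> K) (f : I -> C) (g : K -> C) (l : C) :
  has_sum f l -> (forall k, has_sum (fun i => if p i == k then f i else 0) (g k)) ->
  has_sum g l.
Proof.
move=> hf hg e e0.
have e20 : 0 < e / 2 by rewrite divr_gt0.
have [A hA] := hf _ e20.
exists (p @` A) => B AB.
have /(_ _ e20)[A' hA'] := has_sum_sum (fun k (_ : k \in enum_fset B) => hg k).
pose D := A `|` A'.
(* [D] is large enough for all the fibre sums over [B] at once; its part [D'] lying over [B] still
   contains [A], because [B] contains the image of [A]. *)
pose D' := [fset i in D | p i \in B].
have -> : l - \sum_(i <- B) g i = (l - \sum_(i <- D') f i) -
    (\sum_(k <- B) g k - \sum_(i <- D) \sum_(k <- B) if p i == k then f i else 0).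
  rewrite opprB addrA; congr (_ - _); rewrite -addrA -[LHS]addr0; congr (_ + _).
  apply/eqP; rewrite eq_sym addrC subr_eq0; apply/eqP.
  rewrite /D' -big_fset_condE [RHS]big_mkcond/=; apply: eq_bigr => i _.
  case: ifPn => piB.
    rewrite (big_fsetD1 (p i))//= eqxx big_seq big1 ?addr0// => k.
    by rewrite !inE => /andP[/negbTE + _]; rewrite eq_sym => ->.
  rewrite big_seq big1// => k kB; case: eqP => // pik.
  by rewrite pik kB in piB.
apply: le_lt_trans (ler_normB _ _) _.
rewrite [e]splitr; apply: ltrD.
  apply: hA; apply/fsubsetP => i iA; rewrite !inE/= iA/=.
  by apply: (fsubsetP AB); exact: in_imfset.
by apply: hA'; exact: fsubsetUr.
Qed.


Lemma has_sum_seq (I : choiceType) (s : seq I) (f : I -> C) :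
  uniq s -> (forall i, i \notin s -> f i = 0) -> has_sum f (\sum_(i <- s) f i).
Proof.
move=> us fs.
apply: (@eq_has_sum _ (fun i => \sum_(k <- s) if i == k then f k else 0)).
  move=> i; have [iS|iS] := boolP (i \in s).
    rewrite (bigD1_seq i)//= eqxx big1 ?addr0// => k.
    by rewrite eq_sym => /negbTE->.
  rewrite fs// big_seq big1// => k ks; case: eqP => // ik.
  by rewrite ik ks in iS.
apply: has_sum_sum => k _.
have := @has_sum_finsupp _ [fset k] (fun i => if i == k then f k else 0).
rewrite big_seq_fset1 eqxx; apply => i.
by rewrite inE => /negbTE->.
Qed.

Lemma has_sum_ord (n : nat) (f : nat -> C) :
  (forall i, (n <= i)%N -> f i = 0) -> has_sum f (\sum_(i < n) f i).
Proof.
move=> fn; rewrite -(big_mkord xpredT f); apply: has_sum_seq; first exact: iota_uniq.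
by move=> i; rewrite mem_index_iota/= -leqNgt => /fn.
Qed.

Lemma abs_summable_le (I : choiceType) (f g : I -> C) :
  (forall i, `|f i| <= `|g i|) -> abs_summable g -> abs_summable f.
Proof.
move=> fg [B hB]; exists B => A; apply: le_trans (hB A).
by apply: ler_sum => i _.
Qed.

Lemma abs_summableD (I : choiceType) (f g : I -> C) :
  abs_summable f -> abs_summable g -> abs_summable (fun i => f i + g i).
Proof.
move=> [B hB] [B' hB']; exists (B + B') => A.
apply: le_trans (lerD (hB A) (hB' A)); rewrite -big_split/=.
by apply: ler_sum => i _; exact: ler_normD.
Qed.

Lemma abs_summableZ (I : choiceType) (c : C) (f : I -> C) :
  abs_summable f -> abs_summable (fun i => c * f i).
Proof.
move=> [B hB]; exists (`|c| * B) => A.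
rewrite (eq_bigr (fun i => `|c| * `|f i|)) => [|i _]; last by rewrite normrM.
by rewrite -mulr_sumr ler_wpM2l.
Qed.

Lemma abs_summable_comp (I K : choiceType) (phi : K -> I) (g : I -> K) (f : I -> C) :
  cancel phi g -> abs_summable f -> abs_summable (f \o phi).
Proof.
move=> phiK [B hB]; exists B => A.
have <- := sum_imfset_cancel (fun i => `|f i|) A phiK; exact: hB.
Qed.

Lemma abs_summable_reindex (I K : choiceType) (phi : K -> I) (g : I -> K) (f : I -> C) :
  cancel phi g -> (forall i, f i != 0 -> phi (g i) = i) ->
  abs_summable (f \o phi) -> abs_summable f.
Proof.
move=> phiK fg [B hB]; exists B => A.
rewrite (sum_preimage_cancel A phiK) => [|i]; first exact: hB.
by rewrite normr_eq0; exact: fg.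
Qed.

Lemma abs_summable_finsupp (I : choiceType) (A : {fset I}) (f : I -> C) :
  (forall i, i \notin A -> f i = 0) -> abs_summable f.
Proof.
move=> fA; exists (\sum_(i <- A) `|f i|) => B.
rewrite -[leRHS](_ : \sum_(i <- A `|` B) `|f i| = _).
  rewrite [leRHS](big_fsetID _ (mem B))/= [X in X + _](_ : _ = \sum_(i <- B) `|f i|).
    by rewrite lerDl sumr_ge0.
  by apply: eq_fbigl => x; rewrite !inE/= andbC; case: (x \in B); rewrite ?orbT.
symmetry; apply: big_fset_incl => [|i _ iA]; first exact: fsubsetUl.
by rewrite fA ?normr0.
Qed.

(** A finite set of pairs lies in the product of its two projections, over which the double sum
    factors. *)
Lemma abs_summable_prod (I K : choiceType) (f : I -> C) (g : K -> C) :
  abs_summable f -> abs_summable g ->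
  abs_summable (fun x : I * K => f x.1 * g x.2).
Proof.
move=> [B hB] [B' hB']; exists (B * B') => A.
pose A1 := [fset x.1 | x in A]; pose A2 := [fset x.2 | x in A].
pose P := A1 `*` A2.
have AA : A `<=` P.
  apply/fsubsetP => -[x y] xyA; rewrite in_fsetM/=.
  by apply/andP; split; apply/imfsetP; exists (x, y).
have -> : \sum_(i <- A) `|f i.1 * g i.2| =
    \sum_(i <- P) (if i \in A then `|f i.1 * g i.2| else 0).
  rewrite -(big_fset_incl _ AA) => [|i _ /negbTE-> //].
  by rewrite big_seq [RHS]big_seq; apply: eq_bigr => i ->.
apply: (@le_trans _ _ (\sum_(i <- P) `|f i.1| * `|g i.2|)).
  by apply: ler_sum => i _; case: ifP => _; rewrite ?normrM// mulr_ge0.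
rewrite big_imfset2/=; last by move=> [a b] [a' b'] _ _ [-> ->].
rewrite (eq_bigr (fun i => `|f i| * \sum_(k <- A2) `|g k|)) => [|i _]; last by rewrite mulr_sumr.
rewrite -mulr_suml; apply: ler_pM => //; by apply: sumr_ge0.
Qed.

Lemma real_complex_gt0 (e : C) : 0 < e -> exists2 e' : R, e = e'%:C & 0 < e'.
Proof.
case: e => a b; rewrite ltcE/= => /andP[/eqP -> a0]; by exists a.
Qed.

Lemma real_complex_ge0 (e : C) : 0 <= e -> exists2 e' : R, e = e'%:C & 0 <= e'.
Proof.
case: e => a b; rewrite lecE/= => /andP[/eqP -> a0]; by exists a.
Qed.

(** The sum is the supremum of the finite partial sums, which increase with the set. *)
Lemma nneg_has_sum (I : choiceType) (u : I -> R) (B : R) :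
  (forall i, 0 <= u i) -> (forall A : {fset I}, \sum_(i <- A) u i <= B) ->
  exists l : C, has_sum (fun i => (u i)%:C) l.
Proof.
move=> u0 uB.
pose S := [set \sum_(i <- A) u i | A in [set: {fset I}]]%classic.
have Ssup : has_sup S.
  split; first by exists (\sum_(i <- fset0) u i), fset0.
  by exists B => _ [A _ <-].
exists (sup S)%:C; move=> e /real_complex_gt0[e' -> e'0].
have [_ [A _ <-] hA] := sup_adherent e'0 Ssup.
exists A => A' AA'; rewrite -rmorph_sum/= -rmorphB/= normc_def/= expr0n/= addr0 sqrtr_sqr ltcR.
have SA' : \sum_(i <- A') u i <= sup S by apply: ub_le_sup; [exact: Ssup.2|exists A'].
rewrite ger0_norm ?subr_ge0// ltrBlDr -ltrBlDl; apply: lt_le_trans hA _.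
rewrite [leRHS](big_fsetID _ (mem A))/= [X in _ <= X + _](_ : _ = \sum_(i <- A) u i).
  by rewrite lerDl sumr_ge0.
by apply: eq_fbigl => x; rewrite !inE/= andbC; case: (boolP (x \in A)) => //= /(fsubsetP AA').
Qed.

Lemma abs_summable_has_sum (I : choiceType) (f : I -> C) :
  abs_summable f -> exists l, has_sum f l.
Proof.
move=> [B hB].
pose n i := complex.Re `|f i|.
have nE i : `|f i| = (n i)%:C by rewrite /n normc_def.
have leRe : forall i, `|complex.Re (f i)| <= n i.
  by move=> i; rewrite /n normc_def/= -sqrtr_sqr ler_wsqrtr// lerDl sqr_ge0.
have leIm : forall i, `|complex.Im (f i)| <= n i.
  by move=> i; rewrite /n normc_def/= -sqrtr_sqr ler_wsqrtr// lerDr sqr_ge0.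
have nB (A : {fset I}) : \sum_(i <- A) n i <= complex.Re B.
  have := hB A; rewrite (eq_bigr (fun i => (n i)%:C)) => [|i _]; last exact: nE.
  by rewrite -rmorph_sum/= lecE/= => /andP[].
(* A real family dominated by [n] is [(v + n) - n], a difference of nonnegative families with
   bounded partial sums. *)
have aux (v : I -> R) : (forall i, `|v i| <= n i) ->
    exists l : C, has_sum (fun i => (v i)%:C) l.
  move=> vn.
  have [l1 h1] : exists l : C, has_sum (fun i => (v i + n i)%:C) l.
    apply: (@nneg_has_sum _ _ (complex.Re B + complex.Re B)) => [i|A].
      by rewrite -lerBlDr sub0r; have := vn i; rewrite ler_norml => /andP[].
    rewrite big_split/= lerD// (le_trans _ (nB A))//; apply: ler_sum => i _.
    exact: le_trans (ler_norm _) (vn i).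
  have [l2 h2] : exists l : C, has_sum (fun i => (n i)%:C) l.
    apply: (@nneg_has_sum _ _ (complex.Re B)) => [i|A]; last exact: nB.
    exact: le_trans (normr_ge0 _) (vn i).
  exists (l1 + -1 * l2); apply: eq_has_sum (has_sumD h1 (has_sumZ (-1) h2)) => i.
  by rewrite mulN1r -rmorphB/= addrK.
have [l1 h1] := aux _ leRe; have [l2 h2] := aux _ leIm.
exists (l1 + 'i%C * l2); apply: eq_has_sum (has_sumD h1 (has_sumZ 'i%C h2)) => i.
by rewrite -complexE.
Qed.

Lemma abs_summable_tail (I : choiceType) (f : I -> C) :
  abs_summable f -> forall e : C, 0 < e -> exists A : {fset I},
  forall B : {fset I}, A `<=` B -> \sum_(i <- B `\` A) `|f i| <= e.
Proof.
move=> [B0 hB0] e e0.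
have /abs_summable_has_sum[l h] : abs_summable (fun i => `|f i|).
  by exists B0 => A; under eq_bigr do rewrite normr_id; exact: hB0.
have [A hA] := h _ (divr_gt0 e0 (ltr0Sn _ 1)).
exists A => B AB.
have SE : \sum_(i <- B) `|f i| = \sum_(i <- A) `|f i| + \sum_(i <- B `\` A) `|f i|.
  rewrite [LHS](big_fsetID _ (mem A))/=; congr (_ + _); apply: eq_fbigl => x; rewrite !inE/=.
    by rewrite andbC; case: (boolP (x \in A)) => //= /(fsubsetP AB).
  by rewrite andbC.
have -> : \sum_(i <- B `\` A) `|f i| = `|(l - \sum_(i <- A) `|f i|) - (l - \sum_(i <- B) `|f i|)|.
  rewrite SE -[LHS]ger0_norm ?sumr_ge0//; congr `|_|.
  by ring.
rewrite (le_trans (ler_normB _ _))// [e]splitr; apply: lerD.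
  by apply/ltW/hA; exact: fsubset_refl.
by apply/ltW/hA.
Qed.

Lemma tends_to_unique (u : nat -> C) (l l' : C) :
  tends_to u l -> tends_to u l' -> l = l'.
Proof.
move=> /tends_toP h /tends_toP h'.
exact: (cvg_unique (@norm_hausdorff _ C^o) h h').
Qed.

Lemma eq_tends_to (u v : nat -> C) (l : C) : u =1 v -> tends_to u l -> tends_to v l.
Proof. by move=> /funext->. Qed.

Lemma tends_to_eventually (u : nat -> C) (l : C) (n : nat) :
  (forall m, (n <= m)%N -> u m = l) -> tends_to u l.
Proof. by move=> ul e e0; exists n => m /ul ->; rewrite subrr normr0. Qed.

Lemma tends_to_cst (l : C) : tends_to (fun=> l) l.
Proof. exact: (@tends_to_eventually _ _ 0). Qed.

Lemma tends_toD (u v : nat -> C) (l l' : C) :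
  tends_to u l -> tends_to v l' -> tends_to (fun n => u n + v n) (l + l').
Proof.
move=> hu hv e e0.
have e20 : 0 < e / 2 by rewrite divr_gt0.
have [N hN] := hu _ e20; have [N' hN'] := hv _ e20.
exists (maxn N N') => n; rewrite geq_max => /andP[Nn N'n].
rewrite opprD addrACA [e]splitr (le_lt_trans (ler_normD _ _))//.
by rewrite ltrD ?hN ?hN'.
Qed.

Lemma tends_toM (u v : nat -> C) (l l' : C) :
  tends_to u l -> tends_to v l' -> tends_to (fun n => u n * v n) (l * l').
Proof.
move=> hu hv e e0.
have e20 : 0 < e / 2 by rewrite divr_gt0.
have d0 (x : C) : 0 < `|x| + 1 by rewrite ltr_wpDl.
have [N1 hN1] := hu _ (divr_gt0 e20 (d0 l')).
have [N2 hN2] := hv _ (divr_gt0 e20 (d0 l)).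
have [N3 hN3] := hu _ ltr01.
exists (maxn N1 (maxn N2 N3)) => n; rewrite !geq_max => /and3P[n1 n2 n3].
have -> : l * l' - u n * v n = (l - u n) * l' + u n * (l' - v n) by ring.
rewrite [e]splitr (le_lt_trans (ler_normD _ _))// !normrM ltr_leD//.
  apply: (@le_lt_trans _ _ (`|l - u n| * (`|l'| + 1))).
    by rewrite ler_wpM2l// lerDl.
  by rewrite -ltr_pdivlMr// hN1.
apply: (@le_trans _ _ ((`|l| + 1) * `|l' - v n|)).
  rewrite ler_wpM2r// -[u n](subKr l) (le_trans (ler_normB _ _))// lerD2l.
  exact/ltW/hN3.
by rewrite mulrC -ler_pdivlMr// ltW// hN2.
Qed.

Lemma tends_to_subseq (u : nat -> C) (l : C) (phi : nat -> nat) :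
  (forall n, (n <= phi n)%N) -> tends_to u l -> tends_to (u \o phi) l.
Proof.
move=> phi_ge h e /h[N hN]; exists N => n Nn.
by apply: hN; exact: leq_trans (phi_ge n).
Qed.

(** Dominated convergence for unordered sums; the passages to the limit in the theta and Bailey
    identities rest on it. *)
Lemma tannery (I : choiceType) (f : nat -> I -> C) (f' g : I -> C) (s : nat -> C) (s' : C) :
  abs_summable g -> (forall n i, `|f n i| <= `|g i|) ->
  (forall i, tends_to (fun n => f n i) (f' i)) ->
  (forall n, has_sum (f n) (s n)) -> has_sum f' s' ->
  tends_to s s'.
Proof.
move=> gs fg ff' fs f's'.
move=> e e0.
have e40 : 0 < e / 2 / 2 by rewrite !divr_gt0.
have [A1 hA1] := f's' _ e40; have [A2 hA2] := abs_summable_tail gs e40.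
(* [A1] makes the remainder of [f'] small, and [A2] makes the tail of [g] small, which controls the
   remainder of [f n] uniformly in [n]. *)
pose A := A1 `|` A2.
have cA : tends_to (fun n => \sum_(i <- A) f n i) (\sum_(i <- A) f' i).
  elim: (enum_fset A) => [|i r IH].
    by apply: (@tends_to_eventually _ _ 0) => n _; rewrite !big_nil.
  rewrite big_cons; apply: (eq_tends_to _ (tends_toD (ff' i) IH)) => n.
  by rewrite big_cons.
have [N hN] := cA _ e40.
exists N => n Nn.
have /(_ _ e40)[A3 hA3] := fs n.
pose B := A `|` A3.
have hB : `|\sum_(i <- B) f n i - \sum_(i <- A) f n i| <= e / 2 / 2.
  have AB : A `<=` B by exact: fsubsetUl.
  have -> : \sum_(i <- B) f n i = \sum_(i <- A) f n i + \sum_(i <- B `\` A) f n i.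
    rewrite [LHS](big_fsetID _ (mem A))/=; congr (_ + _); apply: eq_fbigl => x; rewrite !inE/=.
      by rewrite andbC; case: (x \in A1); case: (x \in A2).
    by rewrite andbC.
  rewrite addrC addKr (le_trans (ler_norm_sum _ _ _))//.
  have A2B : A2 `<=` B by apply: fsubset_trans AB; exact: fsubsetUr.
  apply: le_trans (hA2 _ A2B).
  apply: (@le_trans _ _ (\sum_(i <- B `\` A) `|g i|)); first by apply: ler_sum.
  rewrite [leRHS](big_fsetID _ (mem (B `\` A)))/= [X in _ <= X + _](_ : _ = \sum_(i <- B `\` A) `|g i|).
    by rewrite lerDl sumr_ge0.
  apply: eq_fbigl => x; rewrite !inE/=.
  by case: (x \in A1); case: (x \in A2); case: (x \in A3).
have -> : s' - s n = (s' - \sum_(i <- A) f' i) + (\sum_(i <- A) f' i - \sum_(i <- A) f n i)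
   - (\sum_(i <- B) f n i - \sum_(i <- A) f n i) - (s n - \sum_(i <- B) f n i).
  by rewrite [X in _ + X - _ - _]addrC opprB; ring.
have -> : e = e / 2 / 2 + e / 2 / 2 + e / 2 / 2 + e / 2 / 2.
  by rewrite -[RHS]addrA -!splitr.
rewrite (le_lt_trans (ler_normB _ _))// ltrD//; last exact: (hA3 _ (fsubsetUr _ _)).
rewrite (le_lt_trans (ler_normB _ _))// ltr_leD//.
rewrite (le_lt_trans (ler_normD _ _))// ltrD//; last exact: hN.
by apply: hA1; exact: fsubsetUl.
Qed.

End HasSum.

(** * Infinite q-products *)

Section QPochhammer.
Variable R : realType.
Local Notation C := R[i].

Lemma sum_geometric_le (K : numFieldType) (x : K) (n : nat) :
  0 <= x -> x < 1 -> \sum_(i < n) x ^+ i <= (1 - x)^-1.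
Proof.
move=> x0 x1; rewrite -[leRHS]mul1r ler_pdivlMr ?subr_gt0// mulrC.
rewrite (_ : _ * _ = 1 - x ^+ n); first by rewrite lerBlDr lerDl exprn_ge0.
by rewrite -[RHS]opprB subrX1 -mulNr opprB.
Qed.

Lemma prod_1D_geometric_bounded (a x : R) : 0 <= a -> 0 <= x -> x < 1 ->
  exists B : R, forall n, \prod_(k < n) (1 + a * x ^+ k) <= B.
Proof.
move=> a0 x0 x1; exists (expR (a / (1 - x))) => n.
apply: (@le_trans _ _ (expR (\sum_(k < n) a * x ^+ k))).
  rewrite expR_sum; apply: ler_prod => k _.
  by rewrite expR_ge1Dx addr_ge0// mulr_ge0// exprn_ge0.
by rewrite ler_expR -mulr_sumr ler_wpM2l// sum_geometric_le.
Qed.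

Lemma abs_summable_nat (f : nat -> C) (B : C) :
  (forall n, \sum_(i < n) `|f i| <= B) -> abs_summable f.
Proof.
move=> fB; exists B => A.
pose N := (\max_(i <- A) i).+1.
have AN i : i \in A -> (i < N)%N by move=> iA; rewrite ltnS; exact: leq_bigmax_seq.
apply: le_trans (fB N); rewrite -(big_mkord xpredT (fun i => `|f i|)).
rewrite [leRHS](bigID (mem A))/= [X in _ <= X + _](_ : _ = \sum_(i <- A) `|f i|).
  by rewrite lerDl sumr_ge0.
rewrite -big_filter; apply: perm_big; apply: uniq_perm.
- by rewrite filter_uniq// iota_uniq.
- exact: fset_uniq.
move=> i; rewrite mem_filter mem_index_iota/=; case: (boolP (i \in A)) => //= iA.
exact: AN.
Qed.

Lemma abs_summable_geometric (x : C) : `|x| < 1 -> abs_summable (fun n : nat => x ^+ n).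
Proof.
move=> x1; apply: (@abs_summable_nat _ (1 - `|x|)^-1) => n.
by under eq_bigr do rewrite normrX; exact: sum_geometric_le.
Qed.

Lemma has_sum_series (f : nat -> C) (l : C) : abs_summable f -> has_sum f l ->
  tends_to (fun n => \sum_(i < n) f i) l.
Proof.
move=> fs fl.
apply: (@tannery _ _ (fun n i => if (i < n)%N then f i else 0) f f) => //.
- by move=> n i; case: ifP => // _; rewrite normr0.
- by move=> i; apply: (@tends_to_eventually _ _ _ i.+1) => n ->.
- move=> n; rewrite (eq_bigr (fun i : 'I_n => if (i < n)%N then f i else 0)).
    by apply: has_sum_ord => i; rewrite ltnNge => ->.
  by move=> i _; rewrite ltn_ord.
Qed.

Lemma qpoch0 (a p : C) : qpoch a p 0 = 1.
Proof. by rewrite /qpoch big_ord0. Qed.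

Lemma qpochS (a p : C) n : qpoch a p n.+1 = qpoch a p n * (1 - a * p ^+ n).
Proof. by rewrite /qpoch big_ord_recr. Qed.

Lemma qpochD (a p : C) m n : qpoch a p (m + n) = qpoch a p m * qpoch (a * p ^+ m) p n.
Proof.
elim: n => [|n IH]; first by rewrite addn0 qpoch0 mulr1.
by rewrite addnS !qpochS IH exprD; ring.
Qed.

Lemma qpoch_double (a p : C) n :
  qpoch a p n.*2 = qpoch a (p ^+ 2) n * qpoch (a * p) (p ^+ 2) n.
Proof.
elim: n => [|n IH]; first by rewrite !qpoch0 mulr1.
rewrite doubleS !qpochS IH -!exprM mul2n [p ^+ n.*2.+1]exprS; ring.
Qed.

Lemma qpoch_sqr (a p : C) n :
  qpoch a p n * qpoch (- a) p n = qpoch (a ^+ 2) (p ^+ 2) n.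
Proof.
elim: n => [|n IH]; first by rewrite !qpoch0 mulr1.
rewrite !qpochS -IH -!exprM mul2n -addnn exprD; ring.
Qed.

Lemma qpoch_bounded (a p : C) : `|p| < 1 -> exists B : C, forall n, `|qpoch a p n| <= B.
Proof.
have [x pE x0] := real_complex_ge0 (normr_ge0 p).
have [y aE y0] := real_complex_ge0 (normr_ge0 a).
rewrite pE -[1](rmorph1 (real_complex R)) ltcR => x1.
have [B hB] := prod_1D_geometric_bounded y0 x0 x1.
exists B%:C => n; rewrite /qpoch normr_prod.
apply: (@le_trans _ _ (\prod_(k < n) (1 + y * x ^+ k))%:C); last by rewrite lecR.
rewrite rmorph_prod/=; apply: ler_prod => k _; rewrite normr_ge0/=.
rewrite rmorphD rmorph1 rmorphM rmorphXn/= -pE -aE -normrX -normrM.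
by rewrite (le_trans (ler_normB _ _))// normr1.
Qed.

Lemma normr_factor_gt0 (a p : C) k : `|p| < 1 -> `|a| < 1 -> `|a * p ^+ k| < 1.
Proof.
move=> p1 a1; rewrite normrM; apply: le_lt_trans a1.
by rewrite ler_piMr// normrX exprn_ile1// ltW.
Qed.

Lemma subr1_neq0 (x : C) : `|x| < 1 -> 1 - x != 0.
Proof. by apply: contraTneq => /subr0_eq <-; rewrite normr1 ltxx. Qed.

Lemma qpoch_neq0 (a p : C) n : `|p| < 1 -> `|a| < 1 -> qpoch a p n != 0.
Proof.
move=> p1 a1; apply/prodf_neq0 => k _; apply: subr1_neq0.
exact: normr_factor_gt0.
Qed.

(** With [y = |a|] and [t = y |p|^k <= y], one has [1/(1 - t) = 1 + t/(1 - t) <= 1 + t/(1 - y)],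
    which reduces the claim to [prod_1D_geometric_bounded]. *)
Lemma qpochV_bounded (a p : C) : `|p| < 1 -> `|a| < 1 ->
  exists B : C, forall n, `|(qpoch a p n)^-1| <= B.
Proof.
move=> p1' a1'; move: (p1') (a1').
have [x pE x0] := real_complex_ge0 (normr_ge0 p).
have [y aE y0] := real_complex_ge0 (normr_ge0 a).
rewrite pE aE -[1](rmorph1 (real_complex R)) !ltcR => x1 y1.
have z0 : 0 <= y / (1 - y) by rewrite divr_ge0// subr_ge0 ltW.
have [B hB] := prod_1D_geometric_bounded z0 x0 x1.
exists B%:C => n; rewrite /qpoch normfV normr_prod -prodfV.
apply: (@le_trans _ _ (\prod_(k < n) (1 + y / (1 - y) * x ^+ k))%:C); last by rewrite lecR.
rewrite rmorph_prod/=; apply: ler_prod => k _; rewrite invr_ge0 normr_ge0/=.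
have yx0 : 0 <= y * x ^+ k by rewrite mulr_ge0// exprn_ge0.
have yxy : y * x ^+ k <= y by rewrite ler_piMr// exprn_ile1// ltW.
have yx1 : y * x ^+ k < 1 by apply: le_lt_trans y1.
have h : (1 - y * x ^+ k)%:C <= `|1 - a * p ^+ k|.
  rewrite rmorphB rmorph1 rmorphM rmorphXn/= -pE -aE -normrX -normrM.
  by apply: le_trans (lerB_dist _ _); rewrite normr1.
apply: (@le_trans _ _ ((1 - y * x ^+ k)%:C)^-1).
  rewrite lef_pV2// ?posrE ?normr_gt0; first exact: subr1_neq0 (normr_factor_gt0 _ _ _).
  by rewrite ltcR subr_gt0.
rewrite -fmorphV lecR -[leLHS]mul1r ler_pdivrMr ?subr_gt0//.
rewrite mulrBr mulr1 lerBrDr.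
have -> : 1 + y / (1 - y) * x ^+ k = 1 + (y * x ^+ k) / (1 - y) by ring.
set t := y * x ^+ k in yx0 yxy yx1 *.
rewrite lerD2l mulrDl mul1r.
have y1' : 0 < 1 - y by rewrite subr_gt0.
have -> : t / (1 - y) * t = t * t / (1 - y) by ring.
rewrite -(@ler_pM2r _ (1 - y))// mulrDl !divfK ?gt_eqF//.
nra.
Qed.

(** The increments are [- a p^k] times bounded products, hence absolutely summable, and they
    telescope. This shows that the limit in [qpoch_inf] exists. *)
Lemma tends_to_qpoch (a p : C) : `|p| < 1 -> tends_to (qpoch a p) (qpoch_inf a p).
Proof.
move=> p1; pose D k := qpoch a p k.+1 - qpoch a p k.
have [B hB] := qpoch_bounded a p1.
have Ds : abs_summable D.
  apply: (@abs_summable_le _ _ D (fun k => B * `|a| * p ^+ k)).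
    move=> k; rewrite /D qpochS.
    have -> : qpoch a p k * (1 - a * p ^+ k) - qpoch a p k = - (qpoch a p k * a * p ^+ k) by ring.
    rewrite normrN !normrM normr_id ler_wpM2r// ler_wpM2r//.
    by rewrite (ger0_norm (le_trans (normr_ge0 _) (hB 0))) hB.
  by apply: abs_summableZ; exact: abs_summable_geometric.
have [l Dl] := abs_summable_has_sum Ds.
have h : tends_to (qpoch a p) (1 + l).
  apply: (eq_tends_to _ (tends_toD (tends_to_cst 1) (has_sum_series Ds Dl))) => n.
  rewrite /D -(big_mkord xpredT (fun i => qpoch a p i.+1 - qpoch a p i)).
  by rewrite telescope_sumr// qpoch0 addrC subrK.
have -> // : qpoch_inf a p = 1 + l.
apply: (@cvg_lim C^o _ _ _ _ (qpoch a p : nat -> C^o)); last exact/tends_toP.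
exact: norm_hausdorff.
Qed.

Lemma qpoch_infD (a p : C) m : `|p| < 1 ->
  qpoch_inf a p = qpoch a p m * qpoch_inf (a * p ^+ m) p.
Proof.
move=> p1; apply: (@tends_to_unique _ (fun n => qpoch a p (m + n))).
  exact: (tends_to_subseq (leq_addl m) (tends_to_qpoch a p1)).
apply: (eq_tends_to _ (tends_toM (tends_to_cst (qpoch a p m)) (tends_to_qpoch _ p1))) => n.
by rewrite qpochD.
Qed.

Lemma normrX2_lt1 (p : C) : `|p| < 1 -> `|p ^+ 2| < 1.
Proof. by move=> p1; rewrite normrX exprn_ilt1. Qed.

Lemma leq_double_self n : (n <= n.*2)%N.
Proof. by rewrite -addnn leq_addl. Qed.

Lemma qpoch_inf_double (a p : C) : `|p| < 1 ->
  qpoch_inf a p = qpoch_inf a (p ^+ 2) * qpoch_inf (a * p) (p ^+ 2).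
Proof.
move=> p1; have p21 := normrX2_lt1 p1.
apply: (@tends_to_unique _ (fun n => qpoch a p n.*2)).
  exact: (tends_to_subseq leq_double_self (tends_to_qpoch a p1)).
apply: (eq_tends_to _ (tends_toM (tends_to_qpoch a p21) (tends_to_qpoch (a * p) p21))) => n.
by rewrite qpoch_double.
Qed.

Lemma qpoch_inf_sqr (a p : C) : `|p| < 1 ->
  qpoch_inf a p * qpoch_inf (- a) p = qpoch_inf (a ^+ 2) (p ^+ 2).
Proof.
move=> p1; have p21 := normrX2_lt1 p1.
apply: (@tends_to_unique _ (qpoch (a ^+ 2) (p ^+ 2))); last exact: tends_to_qpoch.
apply: (eq_tends_to _ (tends_toM (tends_to_qpoch a p1) (tends_to_qpoch (- a) p1))) => n.
by rewrite qpoch_sqr.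
Qed.

(** The reciprocals of the partial products are bounded, so these stay away from 0. *)
Lemma qpoch_inf_neq0 (a p : C) : `|p| < 1 -> `|a| < 1 -> qpoch_inf a p != 0.
Proof.
move=> p1 a1; have [B hB] := qpochV_bounded p1 a1.
have B0 : 0 < B.
  by apply: lt_le_trans (hB 0); rewrite normr_gt0 invr_eq0 qpoch_neq0.
apply/eqP => q0; have := tends_to_qpoch a p1; rewrite q0.
have BV0 : 0 < B^-1 by rewrite invr_gt0.
move=> /(_ _ BV0) [N /(_ N (leqnn _))]; rewrite sub0r normrN => h.
have := hB N; rewrite normfV -(@lef_pV2 _ _) ?posrE ?invr_gt0 ?normr_gt0 ?qpoch_neq0//.
by rewrite invrK => /le_lt_trans/(_ h); rewrite ltxx.
Qed.

End QPochhammer.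

(** * Values of absolutely convergent sums *)

Section TotalSum.
Variable R : realType.
Local Notation C := R[i].

(** A total function, meaningful only together with a [has_sum] fact; [tsumP] supplies one from
    absolute summability. *)
Definition tsum (I : choiceType) (f : I -> C) : C := summability.sum (f : I -> C^o).

Lemma has_sum_tsum (I : choiceType) (f : I -> C) (l : C) : has_sum f l -> tsum f = l.
Proof. exact: has_sum_lim. Qed.

Lemma tsumP (I : choiceType) (f : I -> C) : abs_summable f -> has_sum f (tsum f).
Proof. by move=> /abs_summable_has_sum[l fl]; rewrite (has_sum_tsum fl). Qed.

Lemma eq_tsum (I : choiceType) (f g : I -> C) : f =1 g -> tsum f = tsum g.
Proof. by move=> /funext->. Qed.

Lemma tsum_reindex (I : choiceType) (phi g : I -> I) (f : I -> C) :
  cancel phi g -> cancel g phi -> abs_summable f -> tsum (f \o phi) = tsum f.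
Proof.
move=> phiK gK /tsumP fs; apply: has_sum_tsum.
by apply/(has_sum_reindex _ phiK) => // i _.
Qed.

Lemma abs_summable_window (f : int -> C) (B : nat) :
  (forall j, f j != 0 -> (`|j| <= B)%N) -> abs_summable f.
Proof.
move=> fB; apply: (@abs_summable_finsupp _ _
  [fset (i%:Z - B%:Z : int) | i in iota 0 (B + B).+1]) => j.
apply: contraNeq => /fB jB; apply/imfsetP => /=.
exists (absz (j + B%:Z)); last by lia.
by rewrite inE/= mem_iota; lia.
Qed.

End TotalSum.

(** * Reciprocal q-factorials on the integers and the q-Chu-Vandermonde sum *)

Section QInverse.
Variables (R : realType) (Q : R[i]).
Hypotheses (Q0 : Q != 0) (Q1 : `|Q| < 1).
Local Notation C := R[i].

(* Extending 1/(Q;Q)_n by 0 to negative n lets finite q-sums be taken over all of Z. *)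
Definition qinv (n : int) : C := if n is Posz k then (qpoch Q Q k)^-1 else 0.

Lemma qinv_neg (n : int) : n < 0 -> qinv n = 0.
Proof. by case: n. Qed.

Lemma qinv_neq0 (n : int) : qinv n != 0 -> 0 <= n.
Proof. by case: n => // n; rewrite eqxx. Qed.

Lemma qinv0 : qinv 0 = 1.
Proof. by rewrite /= qpoch0 invr1. Qed.

(** At [n = 0] both sides vanish, so the recurrence has no boundary exception on the integers. *)
Lemma qinv_pred (n : int) : qinv (n - 1) = (1 - Q ^ n) * qinv n.
Proof.
have [n0|n0] := ltP n 0; first by rewrite !qinv_neg ?mulr0//; lia.
have [->|n1] := eqVneq n 0; first by rewrite expr0z subrr mul0r.
have -> : n = `|n|.-1.+1 by lia.
rewrite (_ : _ - 1 = Posz `|n|.-1) /=; last by lia.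
rewrite qpochS -exprS invfM mulrCA mulfV ?mulr1//.
by rewrite subr1_neq0// normrX exprn_ilt1.
Qed.

Lemma qinv_bounded : exists B : C, forall n, `|qinv n| <= B.
Proof.
have [B hB] := qpochV_bounded Q1 Q1.
exists B => -[n|n] /=; first exact: hB.
by rewrite normr0 (le_trans _ (hB 0)).
Qed.

Lemma tends_to_qinv (k : int) :
  tends_to (fun n : nat => qinv (n%:Z + k)) (qpoch_inf Q Q)^-1.
Proof.
have h : tends_to (fun n => (qpoch Q Q n)^-1) (qpoch_inf Q Q)^-1.
  move: (tends_to_qpoch Q Q1) => /tends_toP h; apply/tends_toP.
  exact: (cvgV (qpoch_inf_neq0 Q1 Q1) h).
move=> e /h[N hN]; exists (N + `|k|)%N => n Nn.
have -> : n%:Z + k = absz (n%:Z + k) by clear -Nn; lia.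
by rewrite /=; apply: hN; clear -Nn; lia.
Qed.

(** Multiplying by [(1 - Q^(N+1)) (1 - Q^(N+1+t))] carries either side at [N + 1] to its value at
    [N]. *)
Lemma q_chu_vandermonde (t N : nat) :
  \sum_(i < N.+1) Q ^+ (i ^ 2 + t * i) * qinv (N%:Z - i%:Z) * qinv i%:Z * qinv (i%:Z + t%:Z)
  = qinv N%:Z * qinv (N%:Z + t%:Z).
Proof.
pose F (N i : nat) := Q ^+ (i ^ 2 + t * i) * qinv (N%:Z - i%:Z) * qinv i%:Z * qinv (i%:Z + t%:Z).
elim: N => [|N IH].
  by rewrite big_ord1 muln0 addn0 subr0 !add0r expr0 qinv0 !mul1r.
(* Zeilberger certificate of the recurrence in N satisfied by the sum. *)
pose G (i : nat) := - (Q ^ (N.+1%:Z - i%:Z) * (1 - Q ^ i%:Z) * (1 - Q ^ (i%:Z + t%:Z)) *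
   F N.+1 i).
have key k : \sum_(i < k) ((1 - Q ^ N.+1%:Z) * (1 - Q ^ (N.+1%:Z + t%:Z)) * F N.+1 i - F N i) = G k.
  elim: k => [|k IHk].
    by rewrite big_ord0 /G expr0z subrr mulr0 !mul0r oppr0.
  rewrite big_ord_recr/= IHk /G /F.
  have -> : N%:Z - k%:Z = (N.+1%:Z - k%:Z) - 1 by lia.
  have -> : N.+1%:Z - k.+1%:Z = (N.+1%:Z - k%:Z) - 1 by lia.
  rewrite qinv_pred.
  have -> : qinv k%:Z = (1 - Q ^ k.+1%:Z) * qinv k.+1%:Z.
    by rewrite -qinv_pred; congr qinv; lia.
  have -> : qinv (k%:Z + t%:Z) = (1 - Q ^ (k.+1%:Z + t%:Z)) * qinv (k.+1%:Z + t%:Z).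
    by rewrite -qinv_pred; congr qinv; lia.
  have -> : (k.+1 ^ 2 + t * k.+1 = (k ^ 2 + t * k) + (k + k + 1 + t))%N by lia.
  rewrite [Q ^+ (_ + (_ + _))]exprD.
  set P := Q ^+ (k ^ 2 + t * k).
  rewrite !(exprD Q) expr1.
  have -> : k.+1%:Z = k%:Z + 1 by lia.
  rewrite !(expfzDr _ _ Q0) !expr1z exprN1 -!exprnP -!invr_expz -!exprnP.
  have y0 : Q ^+ k != 0 by rewrite expf_neq0.
  set y := Q ^+ k in y0 *; set a := Q ^+ N.+1; set T := Q ^+ t.
  field.
  by rewrite y0 Q0.
have F0 (n i : nat) : (n < i)%N -> F n i = 0.
  by move=> ni; rewrite /F [qinv (n%:Z - _)]qinv_neg ?mulr0 ?mul0r//; lia.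
(* At the upper end [N + 2] the certificate vanishes because [F N.+1] does, so the complete sums
   satisfy the recurrence. *)
have := key N.+2; rewrite /G F0// mulr0 oppr0 sumrB -mulr_sumr.
rewrite [X in _ - X]big_ord_recr/= (F0 N N.+1)// addr0 IH.
have -> : qinv N%:Z = (1 - Q ^ N.+1%:Z) * qinv N.+1%:Z.
  by rewrite -qinv_pred; congr qinv; lia.
have -> : qinv (N%:Z + t%:Z) = (1 - Q ^ (N.+1%:Z + t%:Z)) * qinv (N.+1%:Z + t%:Z).
  by rewrite -qinv_pred; congr qinv; lia.
have n1 (n : nat) : (0 < n)%N -> 1 - Q ^ n%:Z != 0.
  by move=> n0; rewrite subr1_neq0// normrX exprn_ilt1// -lt0n.
have := n1 N.+1 isT; have := n1 (N.+1 + t)%N isT; rewrite PoszD => c1 c2 /eqP.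
rewrite mulrACA -mulrBr mulf_eq0 mulf_eq0 (negbTE c1) (negbTE c2)/= subr_eq0 => /eqP.
exact.
Qed.

End QInverse.

Arguments qinv : simpl never.

(** * Bailey pairs with theta numerators *)

Section BaileyPairs.
Variables (R : realType) (Q : R[i]).
Hypotheses (Q0 : Q != 0) (Q1 : `|Q| < 1).
Local Notation C := R[i].
Local Notation u := (qinv Q).
Variables s d : nat.
Hypothesis sd : (s + d = 2)%N.
Hypothesis d0 : (0 < d)%N.

(** The kernel of Bailey pairs relative to [a = Q^s], in bilateral form and restricted to indices
    [d j]. The hypotheses leave only [(s, d) = (0, 2)] and [(1, 1)]. Then [d s = s], so
    [j -> -j - s] exchanges the two factors; and [s + d = 2] makes [j -> 1 - j] exchange [m - d j]
    and [m + s + d j - 2]. *)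
Definition bailey_kernel (m j : int) : C := u (m - d%:Z * j) * u (m + s%:Z + d%:Z * j).
Local Notation W := bailey_kernel.

Definition bailey_sum (f : int -> C) (m : int) : C := tsum (fun j => f j * W m j).
Local Notation T := bailey_sum.

Lemma bailey_kernel_window (m j : int) : W m j != 0 -> (`|j| <= `|m| + 2)%N.
Proof.
rewrite mulf_eq0 negb_or => /andP[/qinv_neq0 h1 /qinv_neq0 h2]; clear -sd d0 h1 h2; nia.
Qed.

Lemma abs_summable_bailey (f : int -> C) (m : int) : abs_summable (fun j => f j * W m j).
Proof.
apply: (@abs_summable_window _ _ (`|m| + 2)) => j.
by rewrite mulf_eq0 negb_or => /andP[_ /bailey_kernel_window].
Qed.

Lemma bailey_sumP (f : int -> C) (m : int) : has_sum (fun j => f j * W m j) (T f m).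
Proof. exact/tsumP/abs_summable_bailey. Qed.

Lemma bailey_sumD (a b : C) (f g : int -> C) (m : int) :
  T (fun j => a * f j + b * g j) m = a * T f m + b * T g m.
Proof.
apply: has_sum_tsum.
apply: (eq_has_sum _ (has_sumD (has_sumZ a (bailey_sumP f m)) (has_sumZ b (bailey_sumP g m)))) => j.
by rewrite mulrDl !mulrA.
Qed.

Lemma eq_bailey_sum (f g : int -> C) (m : int) : f =1 g -> T f m = T g m.
Proof. by move=> /funext->. Qed.

Lemma bailey_sum_pred (f : int -> C) (m : int) :
  T f (m - 1) = T (fun j => (1 - Q ^ (m - d%:Z * j)) * (1 - Q ^ (m + s%:Z + d%:Z * j)) * f j) m.
Proof.
apply: eq_tsum => j; rewrite /bailey_kernel.
have -> : m - 1 - d%:Z * j = m - d%:Z * j - 1 by lia.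
have -> : m - 1 + s%:Z + d%:Z * j = m + s%:Z + d%:Z * j - 1 by lia.
by rewrite !qinv_pred//; ring.
Qed.

Lemma bailey_sum_reflect (f : int -> C) (m : int) :
  T f m = T (fun j => f (- j - s%:Z)) m.
Proof.
have jK : involutive (fun j : int => - j - s%:Z) by move=> j; lia.
rewrite [LHS]/bailey_sum -(tsum_reindex jK jK (abs_summable_bailey f m)).
apply: eq_tsum => j /=; congr (_ * _); rewrite /bailey_kernel mulrC.
by congr (u _ * u _); nia.
Qed.

(* The two factors turn the kernel into one that is invariant under j -> 1 - j. *)
Lemma bailey_sum_antisym (f : int -> C) (m : int) : (forall j, f (1 - j) = - f j) ->
  T (fun j => (1 - Q ^ (m + s%:Z + d%:Z * j)) * (1 - Q ^ (m + s%:Z + d%:Z * j - 1)) * f j) m = 0.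
Proof.
move=> fanti; pose h j := f j * (u (m - d%:Z * j) * u (m + s%:Z + d%:Z * j - 1 - 1)).
have -> : T (fun j => (1 - Q ^ (m + s%:Z + d%:Z * j)) * (1 - Q ^ (m + s%:Z + d%:Z * j - 1)) * f j) m
    = tsum h.
  by apply: eq_tsum => j; rewrite /h/bailey_kernel !qinv_pred//; ring.
have jK : involutive (fun j : int => 1 - j) by move=> j; lia.
have hs : abs_summable h.
  apply: (@abs_summable_window _ _ (`|m| + 4)) => j.
  rewrite !mulf_eq0 !negb_or => /and3P[_ /qinv_neq0 h1 /qinv_neq0 h2]; nia.
have : tsum h = - tsum h.
  rewrite -{1}(tsum_reindex jK jK hs); apply: has_sum_tsum; rewrite -mulN1r.
  apply: (eq_has_sum _ (has_sumZ (-1) (tsumP hs))) => j.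
  rewrite /h/= fanti mulN1r mulNr [u _ * u (_ - 1 - 1)]mulrC; congr (- (_ * (u _ * u _))); nia.
move=> /eqP; rewrite -subr_eq0 opprK -mulr2n mulrn_eq0 => /eqP//.
Qed.

Variables (theta : int -> C) (lam : C).
Hypothesis theta_anti : forall j, theta (1 - j) = - theta j.
Hypothesis theta_sym : forall j,
  theta (- j - s%:Z) * (Q ^ (d%:Z * (- j - s%:Z))) ^+ 2 = lam * (theta j * Q ^ (d%:Z * j)).
Local Notation thetaX := (fun j => theta j * Q ^ (d%:Z * j)).

(** Reflection [j -> -j - s] fixes the kernel, and [theta_sym] trades the weight [x^2] for [lam x],
    where [x = Q^(d j)]. *)
Lemma bailey_sum_sqr (m : int) :
  T (fun j => theta j * (Q ^ (d%:Z * j)) ^+ 2) m = lam * T thetaX m.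
Proof.
rewrite bailey_sum_reflect -[RHS]addr0 -(mul0r (T thetaX m)) -bailey_sumD.
by apply: eq_bailey_sum => j; rewrite theta_sym mul0r addr0.
Qed.

(** Expand the vanishing sum of [bailey_sum_antisym] in powers of [x = Q^(d j)]: its weight is
    [1 - A x + B x^2], and the [x^2] part reduces to the [x] part. *)
Lemma bailey_sum_theta (m : int) :
  T theta m = (Q ^ (m + s%:Z - 1) * (1 + Q) - lam * Q ^ (2 * m + 2 * s%:Z - 1)) * T thetaX m.
Proof.
have := bailey_sum_antisym m theta_anti.
pose A := Q ^ (m + s%:Z - 1) * (1 + Q); pose B := Q ^ (2 * m + 2 * s%:Z - 1).
rewrite (@eq_bailey_sum _ (fun j => 1 * theta j + 1 *
   (B * (theta j * (Q ^ (d%:Z * j)) ^+ 2) + - A * thetaX j))).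
  rewrite !bailey_sumD bailey_sum_sqr => h; apply/eqP; rewrite -subr_eq0; apply/eqP.
  by rewrite -h -/A -/B; ring.
move=> j; rewrite /A /B.
have -> : 2 * m + 2 * s%:Z - 1 = (m + s%:Z) + (m + s%:Z) - 1 by lia.
rewrite !(expfzDr _ _ Q0) exprN1.
by field.
Qed.

(** Lowering [m] multiplies the weight [x] by [(1 - Q^m / x) (1 - Q^(m+s) x)], which produces the
    weights [1], [x] and [x^2]. All three are known multiples of the [x] sum, and the resulting
    coefficient factors. *)
Lemma bailey_sum_thetaX_pred (m : int) :
  T thetaX (m - 1) =
  (1 - Q ^ (2 * m + s%:Z - 1)) * (1 - lam * Q ^ (m + s%:Z)) * T thetaX m.
Proof.
rewrite bailey_sum_pred.
rewrite (@eq_bailey_sum _ (fun j => 1 * ((1 + Q ^ (2 * m + s%:Z)) * thetaX j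
  + - Q ^ m * theta j) + - Q ^ (m + s%:Z) * (theta j * (Q ^ (d%:Z * j)) ^+ 2))).
  rewrite !bailey_sumD bailey_sum_sqr bailey_sum_theta.
  have -> : 2 * m + 2 * s%:Z - 1 = (m + s%:Z) + (m + s%:Z) - 1 by lia.
  have -> : 2 * m + s%:Z - 1 = m + (m + s%:Z) - 1 by lia.
  have -> : 2 * m + s%:Z = m + (m + s%:Z) by lia.
  rewrite !(expfzDr _ _ Q0) exprN1.
  by field.
move=> j.
have -> : 2 * m + s%:Z = m + (m + s%:Z) by lia.
rewrite !(expfzDr _ _ Q0) -!invr_expz.
have : Q ^ (d%:Z * j) != 0 by rewrite expfz_neq0.
by move: (Q ^ (d%:Z * j)) => x x0; field.
Qed.

(** Bailey's lemma with both parameters sent to infinity. For [i = d j >= 0] only [m >= i]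
    contributes; after the shift [m -> i + m] the exponent is [i (i + s) + m^2 + (2 i + s) m], and
    q-Chu-Vandermonde applies with [t = 2 i + s]. *)
Lemma bailey_kernel_sum (N : nat) (j : int) :
  \sum_(m < N.+1) Q ^+ (m ^ 2 + s * m) * u (N%:Z - m%:Z) * W m%:Z j
  = Q ^ (d%:Z * j * (d%:Z * j + s%:Z)) * W N%:Z j.
Proof.
rewrite /bailey_kernel; move: (d%:Z * j) => i.
(* The reflection [i -> -i - s] exchanges the kernel factors and preserves [i (i + s)]; since
   [s <= 1], it makes a negative [i] nonnegative. *)
wlog i0 : i / 0 <= i => [hw|].
  have [/hw//|i0] := leP 0 i; have [i1|i1] := leP 0 (- i - s%:Z); last first.
    have [s1 i2] : s = 1%N /\ i = -1 by lia.
    by move: i1; rewrite s1 i2.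
  have := hw _ i1.
  have -> : (- i - s%:Z) * (- i - s%:Z + s%:Z) = i * (i + s%:Z) by ring.
  have e (n : int) : u (n - (- i - s%:Z)) * u (n + s%:Z + (- i - s%:Z)) = u (n - i) * u (n + s%:Z + i).
    by rewrite mulrC; congr (u _ * u _); ring.
  by rewrite e => <-; apply: eq_bigr => m _; rewrite e.
case: i i0 => // {}j _.
have [Nj|jN] := ltnP N j.
  rewrite [u (N%:Z - j%:Z)]qinv_neg ?mul0r ?mulr0; last by lia.
  by rewrite big1// => m _; rewrite [u (m%:Z - j%:Z)]qinv_neg ?mul0r ?mulr0//; have := ltn_ord m; lia.
have -> : (N.+1 = j + (N - j).+1)%N by lia.
rewrite big_split_ord/= big1 ?add0r => [|m _]; last first.
  by rewrite [u (m%:Z - j%:Z)]qinv_neg ?mul0r ?mulr0//; have := ltn_ord m; lia.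
have := q_chu_vandermonde Q0 Q1 (j + j + s) (N - j).
have -> : u (N - j)%N%:Z = u (N%:Z - j%:Z) by congr u; lia.
have -> : u ((N - j)%N%:Z + (j + j + s)%N%:Z) = u (N%:Z + s%:Z + j%:Z) by congr u; lia.
move=> <-; rewrite mulr_sumr; apply: eq_bigr => m _.
have -> : j%:Z * (j%:Z + s%:Z) = (j * (j + s))%N by lia.
have -> : ((j + m) ^ 2 + s * (j + m) = j * (j + s) + (m ^ 2 + (j + j + s) * m))%N by lia.
rewrite exprD -exprnP -!mulrA; do 2 congr (_ * _).
have := ltn_ord m => mN.
by congr (u _ * (u _ * u _)); lia.
Qed.

Lemma bailey_step (f : int -> C) (N : nat) :
  \sum_(m < N.+1) Q ^+ (m ^ 2 + s * m) * u (N%:Z - m%:Z) * T f m%:Z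
  = T (fun j => Q ^ (d%:Z * j * (d%:Z * j + s%:Z)) * f j) N%:Z.
Proof.
symmetry; apply: has_sum_tsum.
have := has_sum_sum (s := enum 'I_N.+1) (fun (m : 'I_N.+1) _ =>
  has_sumZ (Q ^+ (m ^ 2 + s * m) * u (N%:Z - m%:Z)) (bailey_sumP f m%:Z)).
rewrite big_enum/=; apply: eq_has_sum => j.
rewrite big_enum/= [X in X * W _ _]mulrC -[RHS]mulrA -bailey_kernel_sum mulr_sumr.
by apply: eq_bigr => m _; ring.
Qed.

End BaileyPairs.

(** * The Jacobi triple product *)

(** The number [j (j - 1) / 2], kept in [nat] for negative [j] as well, so that bounds on powers of
    a [p] with [|p| <= 1] apply directly. *)
Definition tri (j : int) : nat := if j is Posz n then 'C(n, 2) else 'C(`|j|.+1, 2).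

Lemma triE (j : int) : 2 * (tri j)%:Z = j * (j - 1).
Proof.
have binE n : 2 * 'C(n.+1, 2)%:Z = n.+1%:Z * n%:Z.
  elim: n => [//|n IH]; rewrite binS bin1 PoszD; lia.
case: j => [[|n]|n] //=; rewrite binE; lia.
Qed.

Lemma tri_succ (j : int) : (tri (j + 1))%:Z = (tri j)%:Z + j.
Proof. have := triE (j + 1); have := triE j; lia. Qed.

Section Theta.
Variable R : realType.
Local Notation C := R[i].

Definition theta (p z : C) (j : int) : C := z ^ j * p ^+ tri j.

Lemma theta0 (p z : C) : theta p z 0 = 1.
Proof. by rewrite /theta expr0z expr0 mulr1. Qed.

Lemma thetaM (p p' z z' : C) (j : int) :
  theta (p * p') (z * z') j = theta p z j * theta p' z' j.
Proof. by rewrite /theta expfzMl exprMn; ring. Qed.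

Lemma theta_succ (p z : C) (j : int) : p != 0 -> z != 0 ->
  theta p z (j + 1) = z * p ^ j * theta p z j.
Proof.
move=> p0 z0; rewrite /theta expfzDr// expr1z !exprnP tri_succ expfzDr//.
by ring.
Qed.

Lemma theta_opp (p z : C) (j : int) : p != 0 -> z != 0 ->
  theta p z (- j) = theta p (p / z) j.
Proof.
move=> p0 z0; rewrite /theta.
have -> : p ^+ tri (- j) = p ^+ tri j * p ^ j.
  rewrite !exprnP -expfzDr//; congr (_ ^ _).
  have := triE (- j); have := triE j; lia.
by rewrite expfzMl exprz_inv; ring.
Qed.

Section FiniteTripleProduct.
Variable p : C.
Hypotheses (p0 : p != 0) (p1 : `|p| < 1).
Local Notation u := (qinv p).

Definition triple_kernel (M N j : int) : C := u (M - j) * u (N + j).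
Local Notation K := triple_kernel.
Definition triple_sum (z : C) (M N : int) : C := tsum (fun j => theta p z j * K M N j).
Local Notation S := triple_sum.

Lemma triple_sumP (f : int -> C) (M N : int) : abs_summable (fun j => f j * K M N j).
Proof.
apply: (@abs_summable_window _ _ (`|M| + `|N|)) => j.
by rewrite !mulf_eq0 !negb_or => /and3P[_ /qinv_neq0 h1 /qinv_neq0 h2]; lia.
Qed.

Lemma triple_sum_opp (z : C) (M N : int) : z != 0 -> S z M N = S (p / z) N M.
Proof.
move=> z0; rewrite /triple_sum -(tsum_reindex (@opprK _) (@opprK _) (triple_sumP _ M N)).
by apply: eq_tsum => j /=; rewrite theta_opp// /triple_kernel opprK mulrC [u _ * _]mulrC mulrC.
Qed.

(** Split [1 - p^(M+N+1) = (1 - p^(M+1-j)) + p^(M+1-j) (1 - p^(N+j))]. The first part lowers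
    [M + 1 - j]; the second lowers [N + j] and becomes [z p^M] times the same sum after
    [j -> j + 1]. *)
Lemma triple_sum_succ (z : C) (M N : int) : z != 0 ->
  (1 - p ^ (M + N + 1)) * S z (M + 1) N = (1 + z * p ^ M) * S z M N.
Proof.
move=> z0.
pose h j := theta p z j * (p ^ (M + 1 - j) * u (M + 1 - j) * u (N + j - 1)).
have hs : abs_summable h.
  apply: (@abs_summable_window _ _ (`|M| + `|N| + 1)) => j.
  rewrite !mulf_eq0 !negb_or => /and3P[_ /andP[_ /qinv_neq0 h1] /qinv_neq0 h2]; lia.
have jK : cancel (fun j : int => j + 1) (fun j => j - 1) by move=> j; lia.
have jK' : cancel (fun j : int => j - 1) (fun j => j + 1) by move=> j; lia.
have h1 : has_sum (fun j => z * p ^ M * (theta p z j * K M N j)) (tsum h).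
  rewrite -(tsum_reindex jK jK' hs).
  have := tsumP (abs_summable_comp jK hs); apply: eq_has_sum => j.
  rewrite /h/= theta_succ// /triple_kernel.
  have -> : M + 1 - (j + 1) = M - j by lia.
  have -> : N + (j + 1) - 1 = N + j by lia.
  have -> : p ^ M = p ^ j * p ^ (M - j) by rewrite -expfzDr//; congr (_ ^ _); lia.
  by ring.
have <- := has_sum_tsum (has_sumZ (1 - p ^ (M + N + 1)) (tsumP (triple_sumP (theta p z) (M + 1) N))).
have h2 := has_sumZ (z * p ^ M) (tsumP (triple_sumP (theta p z) M N)).
rewrite mulrDl mul1r (has_sum_unique h2 h1); apply: has_sum_tsum.
apply: (eq_has_sum _ (has_sumD (tsumP (triple_sumP (theta p z) M N)) (tsumP hs))) => j.
rewrite /triple_kernel /h qinv_pred//.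
have -> : M - j = M + 1 - j - 1 by lia.
rewrite qinv_pred//.
have -> : p ^ (M + N + 1) = p ^ (M + 1 - j) * p ^ (N + j) by rewrite -expfzDr//; congr (_ ^ _); lia.
by ring.
Qed.

Lemma triple_sum0 (z : C) : S z 0 0 = 1.
Proof.
apply: has_sum_tsum.
have := @has_sum_finsupp _ _ [fset (0 : int)] (fun j => theta p z j * K 0 0 j).
rewrite big_seq_fset1 theta0 /triple_kernel subr0 qinv0 !mul1r; apply => j.
rewrite inE; apply: contraNeq.
rewrite !mulf_eq0 !negb_or => /and3P[_ /qinv_neq0 h1 /qinv_neq0 h2]; lia.
Qed.

Lemma qinvV (n : nat) : (u n%:Z)^-1 = qpoch p p n.
Proof. by rewrite /qinv invrK. Qed.

Lemma triple_sum_left (z : C) (M N : nat) : z != 0 ->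
  S (- z) M%:Z N%:Z = qpoch z p M * u (M%:Z + N%:Z) / u N%:Z * S (- z) 0 N%:Z.
Proof.
move=> z0; have uN0 n : u (Posz n) != 0 by rewrite -invr_eq0 qinvV qpoch_neq0.
elim: M => [|M IH]; first by rewrite qpoch0 add0r mul1r mulfV// mul1r.
have c0 : 1 - p ^ (M%:Z + N%:Z + 1) != 0.
  by rewrite subr1_neq0// (_ : _ + 1 = (M + N).+1%:Z) ?normrX ?exprn_ilt1//; lia.
apply: (mulfI c0); have -> : M.+1%:Z = M%:Z + 1 by lia.
rewrite triple_sum_succ ?oppr_eq0// IH qpochS.
have -> : M%:Z + 1 + N%:Z = M%:Z + N%:Z + 1 by lia.
have -> : u (M%:Z + N%:Z) = (1 - p ^ (M%:Z + N%:Z + 1)) * u (M%:Z + N%:Z + 1).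
  by rewrite -qinv_pred// addrK.
by rewrite -exprnP; field; rewrite uN0.
Qed.

(** The recurrence brings [M] down to 0; the reflection [j -> -j] exchanges [M] with [N] and [z]
    with [p / z], and the recurrence then removes [N]. *)
Lemma finite_triple_product (z : C) (M N : nat) : z != 0 ->
  S (- z) M%:Z N%:Z = qpoch z p M * qpoch (p / z) p N * u (M%:Z + N%:Z).
Proof.
move=> z0; have uN0 n : u (Posz n) != 0 by rewrite -invr_eq0 qinvV qpoch_neq0.
rewrite triple_sum_left// triple_sum_opp ?oppr_eq0//.
have -> : p / (- z) = - (p / z) by rewrite invrN mulrN.
rewrite triple_sum_left ?mulf_neq0 ?invr_eq0// triple_sum0 addr0 qinv0 divr1 mulr1.
by field; rewrite uN0.
Qed.

(** The finite triple product at [N = 0], where negative [j] drop out, in the limit [M -> oo]; a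
    common factor [1/(p;p)_oo] cancels. *)
Lemma q_binomial_euler (z : C) : z != 0 -> `|z| < 1 ->
  has_sum (fun n : nat => (- z) ^+ n * p ^+ 'C(n, 2) * u n%:Z) (qpoch_inf z p).
Proof.
move=> z0 z1.
pose f (n : nat) : C := (- z) ^+ n * p ^+ 'C(n, 2) * u n%:Z.
have [B hB] := qinv_bounded p1.
have B0 : `|B| = B by rewrite ger0_norm// (le_trans (normr_ge0 _) (hB 0)).
have fz n : `|f n| <= `|B * z ^+ n|.
  rewrite /f !normrM !normrX normrN B0 mulrC; apply: ler_pM => //.
  by rewrite ler_piMr ?exprn_ge0// exprn_ile1// ltW.
have fs : abs_summable f.
  by apply: (abs_summable_le fz); apply: abs_summableZ; exact: abs_summable_geometric.
have li0 : (qpoch_inf p p)^-1 != 0 by rewrite invr_eq0 qpoch_inf_neq0.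
have h1 : tends_to (fun M => S (- z) (Posz M) 0) (tsum f * (qpoch_inf p p)^-1).
  apply: (@tannery _ _ (fun M n => f n * u (M%:Z - n%:Z)) (fun n => f n * (qpoch_inf p p)^-1)
    (fun n => B * f n)).
  - exact: abs_summableZ.
  - by move=> M n; rewrite mulrC !normrM ler_wpM2r// B0.
  - move=> n; apply: tends_toM; [exact: tends_to_cst | exact: tends_to_qinv].
  - move=> M; have := tsumP (triple_sumP (theta p (- z)) M%:Z 0).
    rewrite -/(triple_sum _ _ _).
    rewrite -(@has_sum_reindex _ _ _ Posz absz); [|by []|].
      by apply: eq_has_sum => n /=; rewrite /f /theta /triple_kernel -exprnP add0r/=; ring.
    move=> j; rewrite !mulf_eq0 !negb_or => /and3P[_ _ /qinv_neq0]; lia.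
  rewrite mulrC; apply: (eq_has_sum _ (has_sumZ (qpoch_inf p p)^-1 (tsumP fs))) => n.
  by rewrite mulrC.
have h2 : tends_to (fun M => S (- z) (Posz M) 0) (qpoch_inf z p * (qpoch_inf p p)^-1).
  apply: (eq_tends_to _ (tends_toM (tends_to_qpoch z p1) (tends_to_qinv p1 0))) => M.
  by rewrite (finite_triple_product M 0 z0) qpoch0 mulr1.
have := tends_to_unique h1 h2 => /(mulIf li0) <-.
exact: tsumP.
Qed.

End FiniteTripleProduct.

(** Writing the base as [z w] makes the two halves alike: the term at [n >= 0] is at most [|z|^n],
    the one at [-n-1] at most [|w|^(n+1)]. *)
Lemma abs_summable_theta (z w : C) : z != 0 -> `|z| < 1 -> `|w| < 1 ->
  abs_summable (theta (z * w) z).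
Proof.
move=> z0 z1 w1; have p1 : `|z * w| <= 1 by rewrite normrM mulr_ile1// ltW.
pose f j := if j is Posz n then theta (z * w) z j else 0.
pose g j := if j is Negz n then theta (z * w) z j else 0.
have : abs_summable (fun j => f j + g j).
  apply: abs_summableD.
    apply: (@abs_summable_reindex _ _ _ Posz absz) => //; first by case=> // n; rewrite eqxx.
    apply: (abs_summable_le _ (abs_summable_geometric z1)) => n /=.
    by rewrite /theta -exprnP normrM ler_piMr// normrX exprn_ile1.
  apply: (@abs_summable_reindex _ _ _ Negz (fun j => if j is Negz n then n else 0%N)) => //.
    by case=> // n; rewrite eqxx.
  apply: (abs_summable_le _ (abs_summableZ w (abs_summable_geometric w1))) => n /=.
  have -> : theta (z * w) z (Negz n) = w ^+ n.+1 * (z * w) ^+ 'C(n.+1, 2).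
    rewrite /theta/= binS bin1 exprD [(z * w) ^+ n.+1]exprMn NegzE -invr_expz -exprnP.
    by field; rewrite expf_neq0.
  by rewrite exprS normrM ler_piMr// normrX exprn_ile1.
by apply: abs_summable_le => -[] n /=; rewrite ?addr0 ?add0r.
Qed.

(** The limit [M = N -> oo] of the finite form; here [p / z = w]. *)
Lemma jacobi_triple_product (z w : C) : z != 0 -> w != 0 -> `|z| < 1 -> `|w| < 1 ->
  tsum (theta (z * w) (- z)) =
  qpoch_inf z (z * w) * qpoch_inf w (z * w) * qpoch_inf (z * w) (z * w).
Proof.
move=> z0 w0 z1 w1; set p := z * w.
have p0 : p != 0 by rewrite mulf_neq0.
have p1 : `|p| < 1 by rewrite normrM mulr_ilt1.
have ths : abs_summable (theta p (- z)).
  have -> : p = (- z) * (- w) by rewrite mulrNN.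
  by apply: abs_summable_theta; rewrite ?normrN ?oppr_eq0.
have [B hB] := qinv_bounded p1.
have B0 : `|B| = B by rewrite ger0_norm// (le_trans (normr_ge0 _) (hB 0)).
set l := qpoch_inf p p.
have l0 : l != 0 by rewrite qpoch_inf_neq0.
have h1 : tends_to (fun M => triple_sum p (- z) (Posz M) (Posz M)) (l^-1 * l^-1 * tsum (theta p (- z))).
  apply: (@tannery _ _ (fun M j => theta p (- z) j * triple_kernel p M%:Z M%:Z j)
    (fun j => l^-1 * l^-1 * theta p (- z) j) (fun j => (B * B) * theta p (- z) j)).
  - exact: abs_summableZ.
  - by move=> M n; rewrite mulrC !normrM B0 ler_wpM2r// ler_pM.
  - move=> j; rewrite mulrC; apply: tends_toM; first exact: tends_to_cst.
    by apply: tends_toM; exact: tends_to_qinv.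
  - by move=> M; apply: tsumP; exact: triple_sumP.
  exact: has_sumZ (tsumP ths).
have h2 : tends_to (fun M => triple_sum p (- z) (Posz M) (Posz M)) (qpoch_inf z p * qpoch_inf w p * l^-1).
  have hu : tends_to (fun M => qinv p (M%:Z + M%:Z)) l^-1.
    have := tends_to_subseq leq_double_self (tends_to_qinv p1 0).
    by apply: eq_tends_to => n /=; congr qinv; lia.
  apply: (eq_tends_to _ (tends_toM (tends_toM (tends_to_qpoch z p1) (tends_to_qpoch w p1)) hu)) => M.
  by rewrite finite_triple_product// /p [z * w]mulrC mulfK.
have := tends_to_unique h1 h2 => e.
apply: (@mulfI _ (l^-1 * l^-1)); first by rewrite mulf_neq0 ?invr_eq0.
by rewrite e; field.
Qed.

End Theta.

(** * The Bailey chain *)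

Section BaileyChain.
Variables (R : realType) (Q : R[i]).
Hypotheses (Q0 : Q != 0) (Q1 : `|Q| < 1).
Local Notation C := R[i].
Local Notation u := (qinv Q).
Variables s d : nat.
Hypothesis sd : (s + d = 2)%N.
Hypothesis d0 : (0 < d)%N.
Local Notation T := (bailey_sum Q s d).

(* t lists n_(r-1), ..., n_2, so that m + x runs through M_(r-1), ..., M_2. *)
Fixpoint chain (t : seq nat) (m : nat) : C :=
  if t is x :: t' then Q ^+ ((m + x) ^ 2 + s * (m + x)) * u x%:Z * chain t' (m + x) else 1.

Definition chain_step (w : nat -> C) (M : nat) : C :=
  Q ^+ (M ^ 2 + s * M) * \sum_(m < M.+1) u (M%:Z - m%:Z) * w m.

(** The gaps are summed one at a time, innermost first: [m] and its gap [x] are replaced by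
    [M = m + x], and the sum at fixed [M] turns the weight [w] into [chain_step w]. *)
Lemma has_sum_chain (k : nat) (w : nat -> C) (l : C) :
  has_sum (fun x : k.-tuple nat * nat => chain x.1 x.2 * w x.2) l ->
  has_sum (iter k chain_step w) l.
Proof.
elim: k w => [|k IH] w h.
  have hK : cancel (fun m : nat => ([tuple] : 0.-tuple nat, m)) snd by [].
  move: h; rewrite -(has_sum_reindex _ hK) => [|[t m] _ /=]; last by rewrite (tuple0 t).
  by apply: eq_has_sum => m /=; rewrite mul1r.
rewrite iterSr; apply: IH.
pose p (x : k.+1.-tuple nat * nat) : k.-tuple nat * nat :=
  ([tuple of behead x.1], (x.2 + thead x.1)%N).
apply: (has_sum_fiber (p := p) h) => -[t M].
(* A point of the fibre over [(t, M)] is determined by [m]. For [m > M] the truncated difference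
   gives a point outside the fibre, where the indicator is 0. *)
have hK : cancel (fun m : nat => ([tuple of (M - m)%N :: t], m)) snd by [].
rewrite -(has_sum_reindex _ hK) => [|[t' m]]; last first.
  rewrite /p/=; case: ifP => [/eqP e _|_ /eqP//]; have [e1 e2] := e.
  congr (_, _); apply: val_inj; rewrite /= -e1 -e2.
  by case/tupleP: t' {e e1 e2} => x t' /=; rewrite theadE addKn.
have -> : chain t M * chain_step w M =
   \sum_(m < M.+1) Q ^+ (M ^ 2 + s * M) * u (M%:Z - m%:Z) * chain t M * w m.
  by rewrite /chain_step mulrA mulr_sumr; apply: eq_bigr => m _; ring.
apply: (@eq_has_sum _ _ (fun m : nat => Q ^+ (M ^ 2 + s * M) * u (M%:Z - m%:Z) * chain t M * w m)).
  move=> m /=; rewrite /p/= theadE.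
  have [Mm|mM] := ltnP M m.
    rewrite qinv_neg; last by clear -Mm; lia.
    rewrite ifF; first by rewrite mulr0 !mul0r.
    by apply/eqP => -[_]; clear -Mm; lia.
  rewrite subnKC// ifT; first by congr (_ * u _ * _ * _); clear -mM; lia.
  by apply/eqP; congr (_, _); exact: val_inj.
apply: has_sum_ord => m Mm.
by rewrite qinv_neg ?mulr0 ?mul0r//; clear -Mm; lia.
Qed.

Variable p0 : C.
Hypotheses (p00 : p0 != 0) (p01 : `|p0| < 1).

(** This is [(-1)^j Q^(k d j (d j + s)) p0^(j(j-1)/2)]: the relation [s = 2 - d] brings the
    quadratic exponent into the form required by Jacobi's identity. *)
Definition chain_theta (k : nat) : int -> C :=
  theta (Q ^+ (2 * d ^ 2 * k) * p0) (- Q ^+ (2 * d * k)).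

Lemma chain_theta_succ (k : nat) (j : int) :
  Q ^ (d%:Z * j * (d%:Z * j + s%:Z)) * chain_theta k j = chain_theta k.+1 j.
Proof.
rewrite /chain_theta.
have -> : Q ^+ (2 * d ^ 2 * k.+1) * p0 = Q ^+ (2 * d ^ 2) * (Q ^+ (2 * d ^ 2 * k) * p0).
  by rewrite mulnS exprD mulrA.
have -> : - Q ^+ (2 * d * k.+1) = Q ^+ (2 * d) * (- Q ^+ (2 * d * k)).
  by rewrite mulnS exprD mulrN.
rewrite thetaM; congr (_ * _).
rewrite /theta !exprnP !exprz_exp -expfzDr//; congr (_ ^ _).
have := triE j; have : s%:Z = 2 - d%:Z by clear -sd; lia.
move=> -> e; rewrite -mulnn !PoszM.
have -> : 2%:Z * (d%:Z * d%:Z) * (tri j)%:Z = d%:Z * d%:Z * (2 * (tri j)%:Z) by ring.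
by rewrite e; ring.
Qed.

Lemma bailey_sum_chain_theta (k N : nat) :
  \sum_(m < N.+1) Q ^+ (m ^ 2 + s * m) * u (N%:Z - m%:Z) * T (chain_theta k) m%:Z
  = T (chain_theta k.+1) N%:Z.
Proof.
rewrite bailey_step//; apply: eq_bailey_sum => j; exact: chain_theta_succ.
Qed.

Lemma iter_chain_step (k : nat) :
  iter k chain_step (fun m => Q ^+ (m ^ 2 + s * m) * T (chain_theta 0) m%:Z) =1
  fun m => Q ^+ (m ^ 2 + s * m) * T (chain_theta k) m%:Z.
Proof.
elim: k => [//|k IH] M /=; rewrite /chain_step; congr (_ * _).
rewrite -bailey_sum_chain_theta; apply: eq_bigr => m _.
by rewrite IH mulrA [u _ * _]mulrC.
Qed.

(** The two Jacobi parameters: [z k * w k] is the base of [chain_theta k]. *)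
Local Notation z := (fun k => Q ^+ (2 * d * k)).
Local Notation w := (fun k => Q ^+ (2 * d * (d - 1) * k) * p0).

Lemma chain_theta_zw (k : nat) : chain_theta k = theta (z k * w k) (- z k).
Proof.
rewrite /chain_theta mulrA -exprD; congr (theta (_ ^+ _ * _) _).
by clear -d0; nia.
Qed.

Lemma normr_w_lt1 (k : nat) : `|w k| < 1.
Proof.
rewrite normrM; apply: le_lt_trans p01.
by rewrite ler_piMl// normrX exprn_ile1// ltW.
Qed.

Lemma normr_z_lt1 (k : nat) : (0 < k)%N -> `|z k| < 1.
Proof.
by move=> k0; rewrite normrX exprn_ilt1// muln_eq0; clear -k0 d0; lia.
Qed.

(** Positivity of [k] gives [|z k| < 1]; at [k = 0] one has [z 0 = 1] and this geometric majorant is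
    lost. *)
Lemma abs_summable_chain_theta (k : nat) : (0 < k)%N -> abs_summable (chain_theta k).
Proof.
move=> k0; rewrite chain_theta_zw -mulrNN; apply: abs_summable_theta.
- by rewrite oppr_eq0 expf_neq0.
- by rewrite normrN normr_z_lt1.
by rewrite normrN normr_w_lt1.
Qed.

Lemma bailey_sum_bounded (f : int -> C) : abs_summable f ->
  exists B : C, forall m, `|T f m| <= B.
Proof.
move=> [B hB]; have [D hD] := qinv_bounded Q1.
have D0 : 0 <= D by rewrite (le_trans (normr_ge0 _) (hD 0)).
exists (D * D * B + 1) => m.
(* Tolerance 1 accounts for the [+ 1]. The finite set [A] depends on [m], but the bound on its
   partial sum does not. *)
have [A hA] := @bailey_sumP _ Q _ _ sd d0 f m _ ltr01.
have := hA A (fsubset_refl _).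
set S := \sum_(i <- A) _ => h.
rewrite -[T f m](subrK S) addrC (le_trans (ler_normD _ _))// lerD ?(ltW h)//.
apply: le_trans (ler_norm_sum _ _ _) _.
apply: (@le_trans _ _ (\sum_(i <- A) D * D * `|f i|)); last first.
  by rewrite -mulr_sumr ler_wpM2l// mulr_ge0.
by apply: ler_sum => i _; rewrite mulrC normrM ler_wpM2r// normrM ler_pM.
Qed.

(** The limit in [N] of the sum for [chain_theta k.+1] is computed twice: through one more Bailey
    step it is [l / (Q;Q)_oo], and through the limit of the kernel it is the theta series over
    [(Q;Q)_oo^2]. *)
Lemma has_sum_bailey_limit (k : nat) (l : C) : (0 < k)%N ->
  has_sum (fun m : nat => Q ^+ (m ^ 2 + s * m) * T (chain_theta k) m%:Z) l ->
  l = tsum (chain_theta k.+1) / qpoch_inf Q Q.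
Proof.
move=> k0 hl; set L := (qpoch_inf Q Q)^-1.
have L0 : L != 0 by rewrite invr_eq0 qpoch_inf_neq0.
have [D hD] := qinv_bounded Q1.
have D0 : 0 <= D by rewrite (le_trans (normr_ge0 _) (hD 0)).
have [B hB] := bailey_sum_bounded (abs_summable_chain_theta k0).
have B0 : 0 <= B by rewrite (le_trans (normr_ge0 _) (hB 0)).
have h1 : tends_to (fun N : nat => T (chain_theta k.+1) N%:Z) (L * l).
  apply: (@tannery _ _
    (fun N m => Q ^+ (m ^ 2 + s * m) * u (N%:Z - m%:Z) * T (chain_theta k) m%:Z)
    (fun m => L * (Q ^+ (m ^ 2 + s * m) * T (chain_theta k) m%:Z))
    (fun m => (D * B) * Q ^+ m)).
  - by apply: abs_summableZ; exact: abs_summable_geometric.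
  - move=> N m; rewrite !normrM (ger0_norm D0) (ger0_norm B0).
    rewrite [X in _ <= X]mulrC mulrA ler_pM// ?mulr_ge0// ler_pM//.
    rewrite !normrX ler_wiXn2l// ?ltW//.
    (* The majorant [Q^m] is available because [m <= m^2 + s m]. *)
    by case: (m) => // m'; clear; nia.
  - move=> m; rewrite mulrA [L * _]mulrC; apply: tends_toM; last exact: tends_to_cst.
    by apply: tends_toM; [exact: tends_to_cst|exact: tends_to_qinv].
  - move=> N; rewrite -bailey_sum_chain_theta.
    apply: (has_sum_ord (f := fun m => Q ^+ (m ^ 2 + s * m) * u (N%:Z - m%:Z) * T (chain_theta k) m%:Z)).
    by move=> m Nm; rewrite qinv_neg ?mulr0 ?mul0r//; clear -Nm; lia.
  exact: has_sumZ hl.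
have ths : abs_summable (chain_theta k.+1) by exact: abs_summable_chain_theta.
have h2 : tends_to (fun N : nat => T (chain_theta k.+1) N%:Z) (L * L * tsum (chain_theta k.+1)).
  apply: (@tannery _ _ (fun N j => chain_theta k.+1 j * bailey_kernel Q s d N%:Z j)
    (fun j => L * L * chain_theta k.+1 j) (fun j => (D * D) * chain_theta k.+1 j)).
  - exact: abs_summableZ.
  - by move=> N j; rewrite mulrC !normrM (ger0_norm D0) ler_wpM2r// ler_pM.
  - move=> j; rewrite mulrC; apply: tends_toM; first exact: tends_to_cst.
    apply: tends_toM; first exact: tends_to_qinv.
    apply: (eq_tends_to _ (tends_to_qinv Q1 (s%:Z + d%:Z * j))) => N.
    by rewrite addrA.
  - by move=> N; exact: bailey_sumP.
  exact: has_sumZ (tsumP ths).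
apply: (mulfI L0); rewrite (tends_to_unique h1 h2) -/L; ring.
Qed.

Lemma bailey_chain_sum (k : nat) (l : C) : (0 < k)%N ->
  has_sum (fun x : k.-tuple nat * nat =>
    chain x.1 x.2 * (Q ^+ (x.2 ^ 2 + s * x.2) * T (theta p0 (- 1)) x.2%:Z)) l ->
  l = qpoch_inf (z k.+1) (z k.+1 * w k.+1) * qpoch_inf (w k.+1) (z k.+1 * w k.+1)
      * qpoch_inf (z k.+1 * w k.+1) (z k.+1 * w k.+1) / qpoch_inf Q Q.
Proof.
move=> k0 h.
have t0 : theta p0 (- 1) = chain_theta 0.
  by rewrite /chain_theta !muln0 !expr0 mul1r.
have := has_sum_chain (w := fun m => Q ^+ (m ^ 2 + s * m) * T (theta p0 (- 1)) m%:Z) h.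
rewrite t0 => /(eq_has_sum (iter_chain_step k)) /(has_sum_bailey_limit k0) ->.
rewrite chain_theta_zw jacobi_triple_product ?mulf_neq0 ?expf_neq0//.
  exact: normr_z_lt1.
exact: normr_w_lt1.
Qed.

End BaileyChain.

(** * The two initial Bailey pairs *)

Section QPow.
Variable R : realType.
Local Notation C := R[i].

Lemma cexpD (x y : C) : cexp (x + y) = cexp x * cexp y.
Proof.
case: x => a b; case: y => c d; rewrite /cexp/= expRD cosD sinD.
by apply/eqP; rewrite eq_complex/=; apply/andP; split; apply/eqP; ring.
Qed.

Lemma normr_cexp (x : C) : `|cexp x| = (expR (complex.Re x))%:C.
Proof.
rewrite /cexp normrM !normc_def/= cos2Dsin2 sqrtr1 mulr1 expr0n addr0 sqrtr_sqr.
by rewrite ger0_norm// expR_ge0.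
Qed.

Variable tau : C.
Local Notation qp := (qpow tau).

Lemma qpowD (x y : rat) : qp (x + y) = qp x * qp y.
Proof. by rewrite /qpow -cexpD rmorphD/=; congr cexp; ring. Qed.

Lemma qpow_neq0 (x : rat) : qp x != 0.
Proof.
rewrite -normr_eq0 normr_cexp; apply/eqP => -[] /eqP.
by rewrite gt_eqF// expR_gt0.
Qed.

Lemma qpow0 : qp 0 = 1.
Proof. by apply: (mulIf (qpow_neq0 0)); rewrite mul1r -qpowD addr0. Qed.

Lemma qpow_nat (n : nat) : qp n%:R = qp 1 ^+ n.
Proof.
elim: n => [|n IH]; first by rewrite qpow0.
by rewrite exprS -IH -qpowD -natr1 addrC.
Qed.

Lemma qpowN (x : rat) : qp (- x) = (qp x)^-1.
Proof. by apply: (mulIf (qpow_neq0 x)); rewrite -qpowD addNr qpow0 mulVf// qpow_neq0. Qed.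

Lemma normr_qpow (x : rat) : `|qp x| = (expR (- (2 * pi * ratr x * complex.Im tau)))%:C.
Proof.
rewrite normr_cexp; congr (expR _)%:C.
have -> : ratr x = (ratr x)%:C :> C by rewrite -(fmorph_rat (real_complex R)).
by case: tau => a b /=; ring.
Qed.

Hypothesis tau0 : 0 < complex.Im tau.

Lemma normr_qpow_le1 (x : rat) : 0 <= x -> `|qp x| <= 1.
Proof.
move=> x0; rewrite normr_qpow -[leRHS](rmorph1 (real_complex R)) lecR -expR0 ler_expR.
have rx : 0 <= ratr x :> R by rewrite ler0q.
rewrite oppr_le0; apply: mulr_ge0 (ltW tau0); apply: mulr_ge0 rx.
by rewrite mulr_ge0// pi_ge0.
Qed.

Lemma normr_qpow1_lt1 : `|qp 1| < 1.
Proof.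
rewrite normr_qpow -[ltRHS](rmorph1 (real_complex R)) ltcR -expR0 ltr_expR.
rewrite oppr_lt0 rmorph1 mulr1 mulr_gt0//.
by rewrite mulr_gt0// pi_gt0.
Qed.

End QPow.

Section InitialBaileyPairs.
Variables (R : realType) (q : R[i]).
Hypotheses (q0 : q != 0) (q1 : `|q| < 1).
Local Notation C := R[i].
Local Notation Q := (q ^+ 2).

Lemma sqr_neq0 : Q != 0. Proof. exact: expf_neq0. Qed.
Let Q0 := sqr_neq0.
Let Q1 : `|Q| < 1 := normrX2_lt1 q1.

Lemma qinv1 (p : C) : qinv p 1 = (1 - p)^-1.
Proof. by rewrite -[LHS]/((qpoch p p 1)^-1) /qpoch big_ord1 expr0 mulr1. Qed.

Lemma exprN1z (j : int) : (-1 : C) ^ (- j) = (-1) ^ j.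
Proof. by rewrite -exprz_inv invrN1. Qed.

Lemma theta_antisym (p : C) (j : int) : theta p (- 1) (1 - j) = - theta p (- 1) j.
Proof.
rewrite /theta; have -> : tri (1 - j) = tri j.
  by have := triE (1 - j); have := triE j; clear; lia.
by rewrite expfzDr ?oppr_eq0 ?oner_eq0// exprN1z expr1z; ring.
Qed.

(** The base [p] is dictated by the reflection symmetry [theta_sym]. For [s = 0] it requires
    [p q^-8 = q^4] with [lam = 1]. For [s = 1] it requires [p^2 = q^6] and [lam = - p q^-4]; the
    negative root gives [lam = q^-1]. *)
Definition pair_base (s : nat) : C := if s is 0%N then q ^+ 12 else - q ^+ 3.

Lemma theta_sym0 (j : int) :
  theta (pair_base 0) (- 1) (- j - 0%:Z) * (Q ^ (2%:Z * (- j - 0%:Z))) ^+ 2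
  = 1 * (theta (pair_base 0) (- 1) j * Q ^ (2%:Z * j)).
Proof.
rewrite subr0 /theta exprN1z mul1r -!mulrA; congr (_ * _).
rewrite /= !exprnP !exprz_exp -!expfzDr//; congr (_ ^ _).
by have := triE (- j); have := triE j; clear; lia.
Qed.

Lemma theta_sym1 (j : int) :
  theta (pair_base 1) (- 1) (- j - 1%:Z) * (Q ^ (1%:Z * (- j - 1%:Z))) ^+ 2
  = q^-1 * (theta (pair_base 1) (- 1) j * Q ^ (1%:Z * j)).
Proof.
have N0 : (-1 : C) != 0 by rewrite oppr_eq0 oner_eq0.
have e := triE (- j - 1%:Z); have e' := triE j.
have h : (tri (- j - 1%:Z))%:Z = (tri j)%:Z + 2 * j + 1 by clear -e e'; lia.
rewrite /theta /= -[- q ^+ 3]mulN1r !exprMn !exprnP h !exprz_exp.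
have s1 : (-1 : C) ^ (- j - 1%:Z) * (-1) ^ ((tri j)%:Z + 2 * j + 1) = (-1) ^ j * (-1) ^ (tri j)%:Z.
  by rewrite -!expfzDr//; congr (_ ^ _); clear; lia.
have -> : q ^ ((tri j)%:Z + 2 * j + 1) = q ^ (tri j)%:Z * (q ^ j * q ^ j * q ^ 1).
  by rewrite -!expfzDr//; congr (_ ^ _); clear; lia.
have -> : q ^ (2%:Z * (1%:Z * (- j - 1%:Z) * 2%:Z)) = (q ^ j * q ^ 1) ^- 4.
  by rewrite exprnP invr_expz -expfzDr// exprz_exp; congr (_ ^ _); clear; lia.
have -> : q ^ (2%:Z * (1%:Z * j)) = q ^ j * q ^ j.
  by rewrite -expfzDr//; congr (_ ^ _); clear; lia.
rewrite (mulrA ((-1) ^ (- j - 1%:Z))) s1 expr1z.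
have x0 : q ^ j != 0 by rewrite expfz_neq0.
by move: (q ^ j) x0 => x x0; field; rewrite q0 x0.
Qed.

Local Notation thetaX s d := (fun j => theta (pair_base s) (- 1) j * Q ^ (d%:Z * j)).

Lemma bailey_sum_base0 : bailey_sum Q 0 2 (thetaX 0%N 2%N) 0 = 1.
Proof.
apply: has_sum_tsum.
have k0 : bailey_kernel Q 0 2 0 0 = 1.
  by rewrite -[LHS]/(qinv Q 0 * qinv Q 0) qinv0 mulr1.
have := @has_sum_finsupp _ _ [fset (0 : int)]
  (fun j => thetaX 0%N 2%N j * bailey_kernel Q 0 2 0 j).
rewrite big_seq_fset1 theta0 k0 mulr0 expr0z !mulr1; apply => j.
rewrite inE; apply: contraNeq.
rewrite !mulf_eq0 !negb_or => /and3P[_ /qinv_neq0 h1 /qinv_neq0 h2]; clear -h1 h2; lia.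
Qed.

(** Only [j = 0] and [j = -1] survive, contributing [(1 + q)/(1 - q^2)]. *)
Lemma bailey_sum_base1 : bailey_sum Q 1 1 (thetaX 1%N 1%N) 0 = qinv q 1.
Proof.
apply: has_sum_tsum.
have k0 : bailey_kernel Q 1 1 0 0 = qinv Q 1.
  by rewrite -[LHS]/(qinv Q 0 * qinv Q 1) qinv0 mul1r.
have k1 : bailey_kernel Q 1 1 0 (-1) = qinv Q 1.
  by rewrite -[LHS]/(qinv Q 1 * qinv Q 0) qinv0 mulr1.
have := @has_sum_finsupp _ _ [fset (0 : int); -1]
  (fun j => thetaX 1%N 1%N j * bailey_kernel Q 1 1 0 j).
rewrite big_fsetU1 ?inE// big_seq_fset1 theta0 k0 k1 mulr0 expr0z !mul1r.
have -> : theta (pair_base 1) (-1) (-1) = q ^+ 3.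
  by rewrite /theta /= exprN1 invrN1 expr1; ring.
have e1 : qinv Q 1 + q ^+ 3 * Q ^ (-1) * qinv Q 1 = qinv q 1.
  rewrite exprN1 !qinv1.
  have n1 : 1 - q != 0 by rewrite subr1_neq0.
  have n2 : 1 - q ^+ 2 != 0 by rewrite subr1_neq0.
  by field; rewrite q0 n1 n2.
rewrite -e1; apply => j.
rewrite !inE; apply: contraNeq.
rewrite !mulf_eq0 !negb_or => /and3P[_ /qinv_neq0 h1 /qinv_neq0 h2]; clear -h1 h2; lia.
Qed.

Section Closed.
Variables s d : nat.
Hypothesis sd : (s + d = 2)%N.
Hypothesis d0 : (0 < d)%N.
Local Notation T := (bailey_sum Q s d).

Lemma theta_sym (j : int) :
  theta (pair_base s) (- 1) (- j - s%:Z) * (Q ^ (d%:Z * (- j - s%:Z))) ^+ 2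
  = (q ^+ s)^-1 * (theta (pair_base s) (- 1) j * Q ^ (d%:Z * j)).
Proof.
have [[-> ->]|[-> ->]] : (s = 0 /\ d = 2)%N \/ (s = 1 /\ d = 1)%N by clear -sd d0; lia.
  by rewrite theta_sym0 invr1.
exact: theta_sym1.
Qed.

(** With [e = 2m + s], [a = q^(e+1)] and [b = q^(e+2)], the step from [m] to [m + 1] divides by
    [(1 - a^2) (1 - b)]. Here [(1 - a) (1 - b)] extends [(q;q)_e] and [1 + a] extends
    [(-q^(s+1);Q)_m]. *)
Lemma bailey_sum_thetaX (m : nat) :
  T (thetaX s d) m%:Z = qinv q (m.*2 + s)%N%:Z / qpoch (- q ^+ s.+1) Q m.
Proof.
have n0 n : qpoch (- q ^+ s.+1) Q n != 0.
  by rewrite qpoch_neq0// normrN normrX exprn_ilt1.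
elim: m => [|m IH].
  rewrite qpoch0 invr1 mulr1 add0n.
  have [[-> ->]|[-> ->]] : (s = 0 /\ d = 2)%N \/ (s = 1 /\ d = 1)%N by clear -sd d0; lia.
    by rewrite bailey_sum_base0 qinv0.
  exact: bailey_sum_base1.
have := bailey_sum_thetaX_pred Q0 Q1 sd d0 (theta_antisym (pair_base s)) theta_sym m.+1%:Z.
have -> : m.+1%:Z - 1 = m%:Z by clear; lia.
rewrite IH.
have -> : qinv q (m.*2 + s)%N%:Z = (1 - q ^+ (m.*2 + s).+1) * (1 - q ^+ (m.*2 + s).+2) *
    qinv q (m.+1.*2 + s)%N%:Z.
  have -> : (m.*2 + s)%N%:Z = (m.+1.*2 + s)%N%:Z - 1 - 1 by clear; lia.
  rewrite !qinv_pred// mulrA; congr ((1 - _) * (1 - _) * _); rewrite exprnP; congr (_ ^ _); clear; lia.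
rewrite qpochS.
have -> : Q ^ (2 * m.+1%:Z + s%:Z - 1) = q ^+ (m.*2 + s).+1 * q ^+ (m.*2 + s).+1.
  by rewrite !exprnP exprz_exp -expfzDr//; congr (_ ^ _); clear; lia.
have -> : (q ^+ s)^-1 * Q ^ (m.+1%:Z + s%:Z) = q ^+ (m.*2 + s).+2.
  by rewrite !exprnP invr_expz exprz_exp -expfzDr//; congr (_ ^ _); clear; lia.
have -> : - q ^+ s.+1 * Q ^+ m = - q ^+ (m.*2 + s).+1.
  by rewrite mulNr -exprM -exprD; congr (- (_ ^+ _)); clear; lia.
set a := q ^+ (m.*2 + s).+1; set b := q ^+ (m.*2 + s).+2.
have [a1 b1] : 1 - a * a != 0 /\ 1 - b != 0.
  split; rewrite subr1_neq0// /a /b -?exprD normrX exprn_ilt1//; by clear; lia.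
have a2 : 1 - - a != 0.
  apply: contraNneq a1 => e.
  by have -> : 1 - a * a = (1 - a) * (1 - - a) by [ring]; rewrite e mulr0.
move=> h; apply: (mulfI (x := (1 - a * a) * (1 - b))); first by rewrite mulf_neq0.
by rewrite -h; field; rewrite n0 a2.
Qed.

(** With [lam = q^-s], the ratio in [bailey_sum_theta] equals [q^s q^e (1 + q^-2 (1 - q^e))], so the
    merged summand is a Bailey [beta_m]. *)
Lemma bailey_sum_pair (m : nat) (e := (m.*2 + s)%N) :
  q ^+ e * (1 + (q ^+ 2)^-1 * (1 - q ^+ e)) * qinv q e%:Z / qpoch (- q ^+ s.+1) Q m
  = (q ^+ s)^-1 * T (theta (pair_base s) (- 1)) m%:Z.
Proof.
rewrite (bailey_sum_theta Q0 Q1 sd d0 (theta_antisym _) theta_sym) bailey_sum_thetaX.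
rewrite -/e mulrA -mulrA !(mulrA _ (qinv _ _)); congr (_ * _).
have -> : Q ^ (m%:Z + s%:Z - 1) = q ^+ e * q ^+ s * (q ^+ 2)^-1.
  by rewrite /e !exprnP invr_expz exprz_exp -!expfzDr//; congr (_ ^ _); clear; lia.
have -> : Q ^ (2 * m%:Z + 2 * s%:Z - 1) = q ^+ e * q ^+ e * q ^+ s * q ^+ s * (q ^+ 2)^-1.
  by rewrite /e !exprnP invr_expz exprz_exp -!expfzDr//; congr (_ ^ _); clear; lia.
by field; rewrite q0 expf_neq0.
Qed.

End Closed.
End InitialBaileyPairs.

(** * The quadratic form *)

Section PartialSums.

(** [scanl] omits the initial 0: the terms are exactly the partial sums of the nonempty prefixes. *)
Definition lin_sum (t : seq nat) : nat := sumn (scanl addn 0 t).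
Definition sqr_sum (t : seq nat) : nat := sumn [seq (x ^ 2)%N | x <- scanl addn 0 t].

Lemma sumn_scanl (a : nat) (t : seq nat) :
  sumn (scanl addn a t) = (size t * a + lin_sum t)%N.
Proof.
rewrite /lin_sum; elim: t a => [//|x t IH] a /=.
by rewrite IH add0n [sumn (scanl addn x t)]IH; ring.
Qed.

Lemma sumn_sqr_scanl (a : nat) (t : seq nat) :
  sumn [seq (x ^ 2)%N | x <- scanl addn a t] = (size t * a ^ 2 + 2 * a * lin_sum t + sqr_sum t)%N.
Proof.
rewrite /sqr_sum; elim: t a => [|x t IH] a /=; first by rewrite mul0n muln0.
rewrite add0n (IH (a + x)%N) (IH x) /lin_sum /= add0n (sumn_scanl x) /lin_sum.
rewrite -!mulnn; ring.
Qed.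

Lemma lin_sum_cons (x : nat) (t : seq nat) :
  lin_sum (x :: t) = ((size t).+1 * x + lin_sum t)%N.
Proof. by rewrite {1}/lin_sum /= add0n sumn_scanl; ring. Qed.

Lemma sqr_sum_cons (x : nat) (t : seq nat) :
  sqr_sum (x :: t) = ((size t).+1 * x ^ 2 + 2 * x * lin_sum t + sqr_sum t)%N.
Proof. by rewrite {1}/sqr_sum /= add0n sumn_sqr_scanl -!mulnn; ring. Qed.

Lemma leq_sqr_sum (t : seq nat) : (sumn t <= sqr_sum t)%N.
Proof.
elim: t => [//|x t IH]; rewrite sqr_sum_cons /= -mulnn mulSn -!addnA.
apply: leq_add; first by case: x => // x; exact: leq_pmulr.
by apply: leq_trans IH _; rewrite addnA leq_addl.
Qed.

Lemma lin_sum_rev (t : seq nat) :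
  (\sum_(i < size t) i.+1 * nth 0 (rev t) i = lin_sum t)%N.
Proof.
elim: t => [|x t IH]; first by rewrite big_ord0.
rewrite lin_sum_cons /= big_ord_recr/= rev_cons nth_rcons size_rev ltnn eqxx addnC -IH.
by congr addn; apply: eq_bigr => i _; rewrite nth_rcons size_rev ltn_ord.
Qed.

(** In the reversed order, entry [i] occurs in [i + 1] partial sums, and [min(i, j) + 1] of them
    contain both entry [i] and entry [j]; so the min matrix is the Gram matrix of the partial
    sums. *)
Lemma sqr_sum_rev (t : seq nat) :
  (\sum_(i < size t) \sum_(j < size t) (minn i j).+1 * (nth 0 (rev t) i * nth 0 (rev t) j)
   = sqr_sum t)%N.
Proof.
elim: t => [|x t IH]; first by rewrite big_ord0.
have nthS (i : 'I_(size t)) : nth 0%N (rev (x :: t)) i = nth 0%N (rev t) i.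
  by rewrite rev_cons nth_rcons size_rev ltn_ord.
have nthx : nth 0%N (rev (x :: t)) (size t) = x.
  by rewrite rev_cons nth_rcons size_rev ltnn eqxx.
have mid : (\sum_(j < size t) (minn (size t) j).+1 * (x * nth 0 (rev t) j) = x * lin_sum t)%N.
  rewrite -lin_sum_rev big_distrr/=; apply: eq_bigr => j _.
  by rewrite (minn_idPr (ltnW (ltn_ord j))); lia.
rewrite sqr_sum_cons -IH big_ord_recr/= big_ord_recr/= nthx minnn.
under [X in (_ + (X + _))%N]eq_bigr do rewrite nthS.
rewrite mid; under eq_bigr do rewrite big_ord_recr/= nthx nthS.
rewrite big_split/=.
under eq_bigr do under eq_bigr do rewrite nthS.
have -> : (\sum_(i < size t) (minn i (size t)).+1 * (nth 0 (rev t) i * x) = x * lin_sum t)%N.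
  by rewrite -mid; apply: eq_bigr => j _; rewrite minnC [(_ * x)%N]mulnC.
by rewrite -mulnn; ring.
Qed.

End PartialSums.

(** * Summation vectors in coordinates and their exponents *)

Section Index.
Variable k : nat.
Local Notation idx := ((k.-tuple nat * nat) * nat)%type.

(* The middle coordinates are stored in reverse order, so that N_(r-1), ..., N_2
   are the successive partial sums of the tuple. *)
Definition to_vec (x : idx) : 'cV[nat]_k.+2 :=
  \col_i nth 0%N (x.2 :: rcons (rev x.1.1) x.1.2) i.

Definition of_vec (n : 'cV[nat]_k.+2) : idx :=
  (([tuple n (inord (k - j)) 0 | j < k], n ord_max 0), n ord0 0).

Lemma to_vec_first (x : idx) : to_vec x ord0 0 = x.2.
Proof. by rewrite mxE. Qed.

Lemma to_vec_last (x : idx) : to_vec x ord_max 0 = x.1.2.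
Proof. by rewrite mxE/= nth_rcons size_rev size_tuple ltnn eqxx. Qed.

Lemma to_vec_mid (x : idx) (i : 'I_k.+2) (j : 'I_k) : i = j.+1 :> nat ->
  to_vec x i 0 = nth 0%N (rev x.1.1) j.
Proof. by move=> ij; rewrite mxE ij/= nth_rcons size_rev size_tuple ltn_ord. Qed.

Lemma to_vecK : cancel to_vec of_vec.
Proof.
move=> -[[t e] n1]; rewrite /of_vec to_vec_first to_vec_last; congr (_, _, _).
apply: eq_from_tnth => j; rewrite tnth_mktuple.
have jk : (k - j.+1 < k)%N by have := ltn_ord j; lia.
rewrite (to_vec_mid _ (j := Ordinal jk)) /=; last first.
  by rewrite inordK; have := ltn_ord j; lia.
rewrite nth_rev ?size_tuple//= (tnth_nth 0%N); congr nth.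
by have := ltn_ord j; lia.
Qed.

Lemma of_vecK : cancel of_vec to_vec.
Proof.
move=> n; apply/colP => i.
have [->|i0] := eqVneq i ord0; first by rewrite to_vec_first.
have [->|im] := eqVneq i ord_max; first by rewrite to_vec_last.
have i1 : (0 < i)%N by rewrite lt0n.
have i2 : (i < k.+1)%N by rewrite ltn_neqAle -ltnS ltn_ord andbT.
have ik : (i.-1 < k)%N by lia.
rewrite (to_vec_mid _ (j := Ordinal ik)) /=; last by lia.
rewrite nth_rev ?size_tuple ?card_ord//.
have kk : (k - i.-1.+1 < k)%N by lia.
rewrite -[X in nth _ _ X]/(nat_of_ord (Ordinal kk)) nth_mktuple /=; congr (n _ _).
by apply: val_inj; rewrite /= inordK; lia.
Qed.

Lemma sum_ord_ends (F : nat -> rat) :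
  \sum_(i < k.+2) F i = F 0%N + \sum_(i < k) F i.+1 + F k.+1.
Proof. by rewrite big_ord_recr big_ord_recl/= . Qed.

Lemma nahm_exponentE (r : nat) (A : 'M[rat]_r) (b : 'cV[rat]_r) (c : rat)
    (d n : 'cV[nat]_r) :
  nahm_exponent A b c d n =
  2^-1 * (\sum_i \sum_j (n i 0)%:R * (n j 0)%:R * A i j * (d j 0)%:R)
  + \sum_i (n i 0)%:R * b i 0 + c.
Proof.
rewrite /nahm_exponent !mxE; congr (_ * _ + _ + _).
  rewrite exchange_big/=; apply: eq_bigr => j _; rewrite !mxE big_distrl/=.
  apply: eq_bigr => i _; rewrite mul_mx_diag !mxE; ring.
by apply: eq_bigr => i _; rewrite !mxE.
Qed.

(** The entries of [A D] linking the last index to the others agree on both sides of the diagonal: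
    the last row of [A] is half the last column there, and is weighted by 2 instead of 1. The middle
    block contributes [sqr_sum], the last row and column [lin_sum]. *)
Lemma nahm_quadratic (x : idx) (n := to_vec x) (r := k.+2) :
  \sum_i \sum_j (n i 0)%:R * (n j 0)%:R * nahmA r i j * (nahm_d r j 0)%:R
  = 2 * (x.2 ^ 2 + x.2 * x.1.2 + 2 * sqr_sum x.1.1 + 2 * x.1.2 * lin_sum x.1.1)%:R
    + k.+1%:R * (x.1.2 ^ 2)%:R.
Proof.
case: x @n => -[t e] n1 n /=.
pose f i := nth 0%N (n1 :: rcons (rev t) e) i.
have f0 : f 0%N = n1 by [].
have fk : f k.+1 = e by rewrite /f/= nth_rcons size_rev size_tuple ltnn eqxx.
have fm (i : 'I_k) : f i.+1 = nth 0%N (rev t) i.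
  by rewrite /f/= nth_rcons size_rev size_tuple ltn_ord.
pose F (i j : nat) : rat := (f i)%:R * (f j)%:R * A_entry r i.+1 j.+1 *
  (if j.+1 == r then 1%N else 2%N)%:R.
have -> : \sum_i \sum_j (n i 0)%:R * (n j 0)%:R * nahmA r i j * (nahm_d r j 0)%:R
    = \sum_(i < k.+2) \sum_(j < k.+2) F i j.
  by apply: eq_bigr => i _; apply: eq_bigr => j _; rewrite !mxE.
rewrite (sum_ord_ends (fun i => \sum_(j < k.+2) F i j)).
rewrite (sum_ord_ends (F 0%N)) (sum_ord_ends (F k.+1)).
have neqk (i : 'I_k) : (i.+2 == k.+2) = false by rewrite !eqSS ltn_eqF.
have F00 : F 0%N 0%N = 2 * n1%:R ^+ 2 by rewrite /F f0 /A_entry/= /r; ring.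
have F0m (j : 'I_k) : F 0%N j.+1 = 0 by rewrite /F /A_entry/= /r neqk; ring.
have F0k : F 0%N k.+1 = n1%:R * e%:R by rewrite /F f0 fk /A_entry/= /r eqxx; ring.
have Fk0 : F k.+1 0%N = n1%:R * e%:R by rewrite /F f0 fk /A_entry/= /r eqxx; field.
have Fkm (j : 'I_k) : F k.+1 j.+1 = 2 * e%:R * (j.+1 * nth 0 (rev t) j)%N%:R.
  by rewrite /F fk fm /A_entry/= /r eqxx neqk natrM -[j.+2%:R]natr1; ring.
have Fkk : F k.+1 k.+1 = k.+1%:R * e%:R ^+ 2.
  by rewrite /F fk /A_entry/= /r eqxx -[k.+2%:R]natr1; ring.
have Fm (i : 'I_k) : \sum_(j < k.+2) F i.+1 j =
    4 * (\sum_(j < k) (minn i j).+1 * (nth 0 (rev t) i * nth 0 (rev t) j))%N%:R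
    + 2 * e%:R * (i.+1 * nth 0 (rev t) i)%N%:R.
  rewrite (sum_ord_ends (F i.+1)).
  have -> : F i.+1 0%N = 0 by rewrite /F /A_entry/= /r neqk; ring.
  have -> : F i.+1 k.+1 = 2 * e%:R * (i.+1 * nth 0 (rev t) i)%N%:R.
    rewrite /F fk fm /A_entry/= /r eqxx neqk (minn_idPl _) ?natrM -?[i.+2%:R]natr1; first ring.
    by have := ltn_ord i; lia.
  rewrite add0r natr_sum mulr_sumr; congr (_ + _); apply: eq_bigr => j _.
  rewrite /F !fm /A_entry/= /r !neqk !minnSS !natrM -[(minn i j).+2%:R]natr1; ring.
rewrite F00 F0k Fk0 Fkk (eq_bigr _ (fun j _ => F0m j)) (eq_bigr _ (fun j _ => Fkm j)).
rewrite (eq_bigr _ (fun j _ => Fm j)) big_split/= -!mulr_sumr -!natr_sum big1_eq.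
have := lin_sum_rev t; have := sqr_sum_rev t; rewrite size_tuple => -> ->.
rewrite !(natrD, natrM, natrX); ring.
Qed.

Lemma nahm_exponent_b (x : idx) (r := k.+2) :
  nahm_exponent (nahmA r) (nahm_b r) (nahm_c r) (nahm_d r) (to_vec x) =
  k.+1%:R / 2 * (x.1.2 ^ 2)%:R + nahm_c r
  + (x.2 ^ 2 + x.2 * x.1.2 + 2 * sqr_sum x.1.1 + 2 * x.1.2 * lin_sum x.1.1 + x.1.2)%:R.
Proof.
rewrite nahm_exponentE nahm_quadratic.
have -> : \sum_i (to_vec x i 0)%:R * nahm_b r i 0 = x.1.2%:R :> rat.
  rewrite (bigD1 ord_max)//= to_vec_last mxE eqxx mulr1 big1 ?addr0// => i im.
  rewrite [nahm_b _ _ _]mxE ifF ?mulr0//; apply: contraNF im => /eqP[im].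
  by apply/eqP/val_inj.
move: (nahm_c r) => c; rewrite [in RHS]natrD.
move: (_ ^ 2 + _ + _ + _)%N => a.
by field.
Qed.

Lemma nahm_exponent_bt (x : idx) (r := k.+2) :
  nahm_exponent (nahmA r) (nahm_bt r) (nahm_ct r) (nahm_d r) (to_vec x) =
  k.+1%:R / 2 * (x.1.2.+1 ^ 2)%:R + nahm_c r
  + (x.2 ^ 2 + x.2 * x.1.2.+1 + 2 * sqr_sum x.1.1 + 2 * x.1.2.+1 * lin_sum x.1.1 + x.1.2.+1)%:R
  - 2.
Proof.
rewrite nahm_exponentE nahm_quadratic.
have -> : \sum_i (to_vec x i 0)%:R * nahm_bt r i 0 =
    (x.2 + 2 * lin_sum x.1.1 + r * x.1.2)%N%:R :> rat.
  case: x => -[t e] n1 /=.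
  pose f i := nth 0%N (n1 :: rcons (rev t) e) i.
  rewrite (eq_bigr (fun i : 'I_k.+2 => (f i)%:R * bt_entry r i.+1)) => [|i _]; last first.
    by rewrite !mxE.
  rewrite (sum_ord_ends (fun i => (f i)%:R * bt_entry r i.+1)).
  have -> : f k.+1 = e by rewrite /f/= nth_rcons size_rev size_tuple ltnn eqxx.
  rewrite (eq_bigr (fun i : 'I_k => 2 * (i.+1 * nth 0 (rev t) i)%N%:R)) => [|i _]; last first.
    rewrite /f/= nth_rcons size_rev size_tuple ltn_ord /bt_entry/= /r !eqSS ltn_eqF//.
    by rewrite natrM -[i.+2%:R]natr1; ring.
  rewrite -mulr_sumr -natr_sum; have := lin_sum_rev t; rewrite size_tuple => ->.
  rewrite /bt_entry/= /r eqxx !natrD !natrM; ring.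
(* The quotient is exact: [(4r-7)^2 - (37-4r) = (16r-4)(r-3)], and [r - 3 = k - 1]. *)
have -> : nahm_ct r = nahm_c r + (k%:R - 1) / 2.
  rewrite /nahm_ct /nahm_c /r -!natr1.
  have : (32 * k.+2%:R - 8 : rat) != 0.
    by rewrite gt_eqF// subr_gt0 -[k.+2%:R]natr1 -natr1; have : 0 <= k%:R :> rat by []; lra.
  rewrite -[k.+2%:R]natr1 -natr1 => h; field.
  by move: h; apply: contra => /eqP h; apply/eqP; rewrite -h; ring.
move: (nahm_c r) (sqr_sum _) (lin_sum _) x.1.2 x.2 => c S2 S1 e n1.
rewrite -[e.+1]addn1 -!mulnn !(natrD, natrM) /r -!natr1.
by field.
Qed.

End Index.

(** * The two Nahm sums *)

Lemma has_sum_iterated (R : realType) (I K : choiceType) (f : I * K -> R[i]) (g : I -> R[i])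
    (l : R[i]) :
  has_sum f l -> (forall i, has_sum (fun j => f (i, j)) (g i)) -> has_sum g l.
Proof.
move=> fl fg; apply: (has_sum_fiber (p := fst) fl) => i.
have hK : cancel (fun j : K => (i, j)) snd by [].
rewrite -(has_sum_reindex _ hK) => [|[i' j] /=].
  by apply: (eq_has_sum _ (fg i)) => j /=; rewrite eqxx.
by case: (i' =P i) => [->//|_]; rewrite eqxx.
Qed.

Lemma abs_summable_tuple (R : realType) (k : nat) (f : nat -> R[i]) :
  abs_summable f -> abs_summable (fun t : k.-tuple nat => \prod_(x <- t) f x).
Proof.
move=> fs; elim: k => [|k IH].
  apply: (@abs_summable_finsupp _ _ [fset [tuple]]) => t.
  by rewrite (tuple0 t) inE eqxx.
pose phi (x : nat * k.-tuple nat) : k.+1.-tuple nat := [tuple of x.1 :: x.2].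
pose g (t : k.+1.-tuple nat) : nat * k.-tuple nat := (thead t, [tuple of behead t]).
have gK : cancel g phi.
  by case/tupleP => x t; apply: val_inj; rewrite /= theadE.
have phiK : cancel phi g.
  by move=> [x t]; congr (_, _); apply: val_inj.
apply: (abs_summable_reindex phiK) => [t _|]; first exact: gK.
apply: (abs_summable_le _ (abs_summable_prod fs IH)) => -[x t] /=.
by rewrite big_cons.
Qed.

Lemma chainE (R : realType) (Q : R[i]) (s : nat) (t : seq nat) (m : nat) :
  chain Q s t m =
  Q ^+ (size t * (m ^ 2 + s * m) + (2 * m + s) * lin_sum t + sqr_sum t) *
  \prod_(x <- t) qinv Q x%:Z.
Proof.
elim: t m => [|x t IH] m; first by rewrite /= big_nil muln0 mulr1 expr0.
rewrite /= IH big_cons lin_sum_cons sqr_sum_cons.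
rewrite mulrACA -exprD; congr (_ ^+ _ * _).
rewrite -!mulnn; ring.
Qed.

Section NahmTerm.
Variables (R : realType) (tau : R[i]) (k : nat).
Hypothesis tau0 : 0 < complex.Im tau.
Local Notation C := R[i].
Local Notation idx := ((k.-tuple nat * nat) * nat)%type.
Local Notation qp := (qpow tau).
Local Notation q := (qpow tau 1).
Local Notation Q := (qpow tau 1 ^+ 2).
Local Notation r := k.+2.

Let q0 : q != 0 := qpow_neq0 tau 1.
Let q1 : `|q| < 1 := normr_qpow1_lt1 tau0.
Let Q0 : Q != 0 := sqr_neq0 q0.
Let Q1 : `|Q| < 1 := normrX2_lt1 q1.

(** Everything but the [(q;q)] denominator. Half-integral exponents come only from [(r-1)/2 * n_r^2]
    and fractional constants only from [nahm_c]; both stay in [qp], and the rest is a natural power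
    of [q]. *)
Definition common_factor (x : idx) : C :=
  qp (k.+1%:R / 2 * (x.1.2 ^ 2)%:R + nahm_c r) *
  q ^+ (x.2 ^ 2 + x.2 * x.1.2 + 2 * sqr_sum x.1.1 + 2 * x.1.2 * lin_sum x.1.1 + x.1.2) *
  \prod_(y <- x.1.1) qinv Q y%:Z * qinv Q x.2%:Z.

Lemma nahm_denominator (x : idx) :
  (\prod_i qpoch (qp (nahm_d r i 0)%:R) (qp (nahm_d r i 0)%:R) (to_vec x i 0))^-1
  = \prod_(y <- x.1.1) qinv Q y%:Z * qinv Q x.2%:Z * qinv q x.1.2%:Z.
Proof.
case: x => -[t e] n1 /=.
rewrite big_ord_recl big_ord_recr/= to_vec_first /=.
have -> : lift ord0 ord_max = ord_max :> 'I_r by apply: val_inj.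
rewrite to_vec_last /= !mxE/= eqxx !qpow_nat expr1.
rewrite (eq_bigr (fun i : 'I_k => qpoch Q Q (nth 0%N (rev t) i))) => [|i _]; last first.
  rewrite (to_vec_mid _ (j := i))//= !mxE/=.
  by rewrite /bump/= add1n !eqSS ltn_eqF// !qpow_nat.
have -> : \prod_(i < k) qpoch Q Q (nth 0%N (rev t) i) = \prod_(y <- t) qpoch Q Q y.
  rewrite (perm_big (rev t)); last by rewrite perm_sym perm_rev.
  by rewrite (big_nth 0%N) size_rev size_tuple big_mkord.
rewrite !invfM -[(\prod_(y <- t) _)^-1]prodfV /qinv; ring.
Qed.

Lemma nahm_term_b (x : idx) :
  nahm_term (nahmA r) (nahm_b r) (nahm_c r) (nahm_d r) tau (to_vec x)
  = common_factor x * qinv q x.1.2%:Z.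
Proof.
rewrite /nahm_term nahm_denominator nahm_exponent_b qpowD qpow_nat /common_factor; ring.
Qed.

Lemma nahm_term_bt (t : k.-tuple nat) (e n1 : nat) :
  nahm_term (nahmA r) (nahm_bt r) (nahm_ct r) (nahm_d r) tau (to_vec ((t, e), n1))
  = common_factor ((t, e.+1), n1) * (Q^-1 * qinv q e%:Z).
Proof.
rewrite /nahm_term nahm_denominator nahm_exponent_bt/= /common_factor/=.
rewrite [qp (_ - 2)]qpowD qpowN (qpow_nat tau 2) [qp (_ + _%:R)]qpowD (qpow_nat tau (_ + _)); ring.
Qed.

Definition geometric_majorant (x : idx) : C :=
  \prod_(y <- x.1.1) q ^+ y * q ^+ x.1.2 * q ^+ x.2.

Lemma abs_summable_majorant : abs_summable geometric_majorant.
Proof.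
have gs := abs_summable_geometric q1.
have h := abs_summable_prod (abs_summable_prod (abs_summable_tuple k gs) gs) gs.
by apply: (abs_summable_le _ h) => -[[t e] n1].
Qed.

(** A linear lower bound on the exponent is enough for convergence: [n_1 <= n_1^2],
    [sumn t <= sqr_sum t], and the linear term supplied by [nahm_b] handles [n_r]. The power with
    exponent [(r-1)/2 * n_r^2] is merely bounded by 1. *)
Lemma common_factor_bounded : exists B : C, forall x, `|common_factor x| <= `|B * geometric_majorant x|.
Proof.
have [D hD] := qinv_bounded Q1.
have D0 : 0 <= D by rewrite (le_trans (normr_ge0 _) (hD 0)).
exists (qp (nahm_c r) * (D ^+ k * D)) => -[[t e] n1]; rewrite /common_factor /geometric_majorant /=.
have -> : \prod_(y <- t) q ^+ y = q ^+ sumn t.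
  by elim: (tval t) => [|y t' IH]; rewrite ?big_nil ?big_cons ?expr0//= exprD IH.
have h1 : `|qp (k.+1%:R / 2 * (e ^ 2)%:R)| <= 1.
  by apply: normr_qpow_le1.
have h2 : `|q ^+ (n1 ^ 2 + n1 * e + 2 * sqr_sum t + 2 * e * lin_sum t + e)| <=
    `|q ^+ sumn t| * `|q ^+ e| * `|q ^+ n1|.
  have hn : (sumn t + e + n1 <= n1 ^ 2 + n1 * e + 2 * sqr_sum t + 2 * e * lin_sum t + e)%N.
    have h : (n1 <= n1 ^ 2)%N by rewrite -mulnn; case: (n1) => // m; exact: leq_pmulr.
    by have := leq_sqr_sum t; lia.
  by rewrite -!normrM -!exprD !normrX; apply: ler_wiXn2l hn => //; exact: ltW.
have h3 : `|\prod_(y <- t) qinv Q y%:Z| <= D ^+ k.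
  rewrite normr_prod -[k in D ^+ k](size_tuple t).
  elim: (tval t) => [|y t' IH]; first by rewrite big_nil expr0.
  rewrite big_cons /= [D ^+ _]exprS; apply: ler_pM => //; exact: prodr_ge0.
rewrite qpowD; move: (qp (k.+1%:R / 2 * _)) (qp (nahm_c r)) h1 => a c h1.
rewrite !normrM (ger0_norm D0) (ger0_norm (exprn_ge0 k D0)).
have -> : `|c| * (D ^+ k * D) * (`|q ^+ sumn t| * `|q ^+ e| * `|q ^+ n1|)
   = 1 * `|c| * (`|q ^+ sumn t| * `|q ^+ e| * `|q ^+ n1|) * D ^+ k * D by ring.
by repeat (apply: ler_pM; rewrite ?mulr_ge0//).
Qed.

Lemma abs_summable_common_factor (g : int -> C) (B : C) : (forall n, `|g n| <= B) ->
  abs_summable (fun x : idx => common_factor x * g x.1.2%:Z).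
Proof.
move=> gB; have [D hD] := common_factor_bounded.
apply: (@abs_summable_le _ _ _ (fun x => B * (D * geometric_majorant x))); last first.
  by do 2 apply: abs_summableZ; exact: abs_summable_majorant.
move=> x; rewrite normrM [leRHS]normrM mulrC ler_pM//.
by rewrite (ger0_norm (le_trans (normr_ge0 _) (gB 0))).
Qed.

(* The first series at n_r = e plus the second one at n_r = e - 1. *)
Definition combined_term (x : idx) : C :=
  common_factor x * (qinv q x.1.2%:Z + Q^-1 * qinv q (x.1.2%:Z - 1)).

Lemma has_sum_combined :
  abs_summable combined_term /\
  has_sum combined_term
    (nahm_sum (nahmA r) (nahm_b r) (nahm_c r) (nahm_d r) tau +
     nahm_sum (nahmA r) (nahm_bt r) (nahm_ct r) (nahm_d r) tau).
Proof.
have [D hD] := qinv_bounded q1.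
pose f1 (x : idx) := common_factor x * qinv q x.1.2%:Z.
pose f2 (x : idx) := common_factor x * (Q^-1 * qinv q (x.1.2%:Z - 1)).
have fs1 : abs_summable f1 by exact: (abs_summable_common_factor (g := qinv q) (B := D)).
have fs2 : abs_summable f2.
  apply: (abs_summable_common_factor (g := fun n => Q^-1 * qinv q (n - 1)) (B := `|Q^-1| * D)) => n.
  by rewrite normrM ler_wpM2l.
have E x : f1 x + f2 x = combined_term x by rewrite /combined_term mulrDr.
split.
  by apply: (abs_summable_le _ (abs_summableD fs1 fs2)) => x; rewrite E.
apply: (eq_has_sum E); apply: has_sumD.
  have -> : nahm_sum (nahmA r) (nahm_b r) (nahm_c r) (nahm_d r) tau = tsum f1.
    apply: has_sum_tsum; apply/(has_sum_reindex _ (@to_vecK k)) => [n _|]; first exact: of_vecK.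
    by apply: (eq_has_sum _ (tsumP fs1)) => x; rewrite /= nahm_term_b.
  exact: tsumP.
have -> : nahm_sum (nahmA r) (nahm_bt r) (nahm_ct r) (nahm_d r) tau = tsum f2; last exact: tsumP.
apply: has_sum_tsum; apply/(has_sum_reindex _ (@to_vecK k)) => [n _|]; first exact: of_vecK.
(* The shift [e -> e + 1] misses only [e = 0], where [f2] vanishes because [qinv q (-1) = 0]. *)
have hK : cancel (fun x : idx => ((x.1.1, x.1.2.+1), x.2) : idx)
  (fun x : idx => ((x.1.1, x.1.2.-1), x.2)) by move=> [[t e] n1].
have := tsumP fs2; rewrite -(has_sum_reindex _ hK) => [|[[t [|e]] n1]]//=; last first.
  by rewrite /f2/= mulr0 mulr0 eqxx.
apply: eq_has_sum => -[[t e] n1] /=; rewrite /f2/= nahm_term_bt.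
by congr (_ * (_ * qinv _ _)); clear; lia.
Qed.

Section Parity.
Variables s d : nat.
Hypothesis sd : (s + d = 2)%N.
Hypothesis d0 : (0 < d)%N.

Definition with_parity (x : idx) : idx := ((x.1.1, (x.1.2.*2 + s)%N), x.2).

Lemma has_sum_over_n1 (e : nat) :
  has_sum (fun n : nat => q ^+ (n ^ 2 + n * e) * qinv Q n%:Z) (qpoch_inf (- q ^+ e.+1) Q).
Proof.
have z0 : - q ^+ e.+1 != 0 by rewrite oppr_eq0 expf_neq0.
have z1 : `|- q ^+ e.+1| < 1 by rewrite normrN normrX exprn_ilt1.
apply: (eq_has_sum _ (q_binomial_euler Q0 Q1 z0 z1)) => n.
rewrite opprK -!exprM -exprD; congr (_ ^+ _ * _).
have : ('C(n, 2) * 2 = n * n.-1)%N.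
  by case: n => // n; have := triE n.+1 => /=; lia.
by case: n => [|n] /=; rewrite -mulnn; lia.
Qed.

Lemma combined_term_parity (t : k.-tuple nat) (m n1 : nat) (e := (m.*2 + s)%N) :
  combined_term (with_parity ((t, m), n1)) =
  qp (nahm_c r + k.+1%:R / 2 * s%:R) *
  (chain Q s t m * (Q ^+ (m ^ 2 + s * m) *
    (q ^+ e * (1 + Q^-1 * (1 - q ^+ e)) * qinv q e%:Z))) *
  (q ^+ (n1 ^ 2 + n1 * e) * qinv Q n1%:Z).
Proof.
rewrite /combined_term /common_factor /with_parity/= -/e chainE qinv_pred// -exprnP.
have -> : qp (k.+1%:R / 2 * (e ^ 2)%:R + nahm_c r) *
    q ^+ (n1 ^ 2 + n1 * e + 2 * sqr_sum t + 2 * e * lin_sum t + e) =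
    qp (nahm_c r + k.+1%:R / 2 * s%:R) *
    Q ^+ (size t * (m ^ 2 + s * m) + (2 * m + s) * lin_sum t + sqr_sum t) *
    Q ^+ (m ^ 2 + s * m) * q ^+ e * q ^+ (n1 ^ 2 + n1 * e).
  rewrite -!exprM -!qpow_nat -!qpowD size_tuple; congr qp.
  (* Since [s] is 0 or 1, [(2m+s)^2 = 4m^2 + 4ms + s]: the last term goes to the constant prefactor,
     the others to the powers of [Q]. *)
  have ss : (s * s = s)%N by case: s sd => [|[|s']]//; clear -d0; lia.
  have ssr : s%:R * s%:R = s%:R :> rat by rewrite -natrM ss.
  rewrite /e -muln2 !(natrD, natrM, natrX) -!natr1.
  have -> : (m%:R * 2 + s%:R : rat) ^+ 2 = 4 * m%:R ^+ 2 + 4 * m%:R * s%:R + s%:R.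
    by rewrite -[X in _ = _ + X]ssr; ring.
  by move: (nahm_c r) => c; field.
by ring.
Qed.

Local Notation T := (bailey_sum Q s d).

Lemma has_sum_parity (l : C) : (0 < k)%N ->
  has_sum (combined_term \o with_parity) l ->
  l = qp (nahm_c r + k.+1%:R / 2 * s%:R) * (q ^+ s)^-1 * qpoch_inf (- q ^+ s.+1) Q *
    (let z := Q ^+ (2 * d * k.+1) in
     let w := Q ^+ (2 * d * (d - 1) * k.+1) * pair_base q s in
     qpoch_inf z (z * w) * qpoch_inf w (z * w) * qpoch_inf (z * w) (z * w) / qpoch_inf Q Q).
Proof.
move=> k0 h.
set K := qp _ * _ * _.
have zs1 : `|- q ^+ s.+1| < 1 by rewrite normrN normrX exprn_ilt1.
have K0 : K != 0.
  apply: mulf_neq0; last exact: qpoch_inf_neq0.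
  by apply: mulf_neq0; [exact: qpow_neq0 | rewrite invr_eq0 expf_neq0].
pose H (x : k.-tuple nat * nat) := chain Q s x.1 x.2 *
  (Q ^+ (x.2 ^ 2 + s * x.2) * T (theta (pair_base q s) (- 1)) x.2%:Z).
have h' : has_sum (fun x => K * H x) l.
  apply: (has_sum_iterated h) => -[t m].
  pose e := (m.*2 + s)%N.
  pose B := qp (nahm_c r + k.+1%:R / 2 * s%:R) * (chain Q s t m * (Q ^+ (m ^ 2 + s * m) *
    (q ^+ e * (1 + Q^-1 * (1 - q ^+ e)) * qinv q e%:Z))).
  (* The product from the sum over [n_1] is [(-q^(s+1);Q)_oo] divided by [(-q^(s+1);Q)_m], which is
     the denominator found in [bailey_sum_pair]; what remains outside [H] is the constant [K]. *)
  have -> : K * H (t, m) = B * qpoch_inf (- q ^+ e.+1) Q.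
    have qn : qpoch (- q ^+ s.+1) Q m != 0 by rewrite qpoch_neq0.
    have := bailey_sum_pair q0 q1 sd d0 m; rewrite -/e => /(canRL (divfK qn)) pairE.
    rewrite /B /H /K /= pairE (qpoch_infD _ m Q1).
    have -> : - q ^+ s.+1 * Q ^+ m = - q ^+ e.+1.
      by rewrite mulNr -exprM -exprD; congr (- (_ ^+ _)); rewrite /e; clear; lia.
    by ring.
  apply: (eq_has_sum _ (has_sumZ B (has_sum_over_n1 e))) => n1.
  by rewrite /= combined_term_parity.
have {}h' : has_sum H (K^-1 * l).
  by apply: (eq_has_sum _ (has_sumZ K^-1 h')) => x; rewrite mulKf.
have p00 : pair_base q s != 0 by case: (s) => [|s'] /=; rewrite ?oppr_eq0 expf_neq0.
have p01 : `|pair_base q s| < 1 by case: (s) => [|s'] /=; rewrite ?normrN normrX exprn_ilt1.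
have := bailey_chain_sum Q0 Q1 sd d0 p00 p01 k0 h' => /= <-.
by rewrite mulVKf.
Qed.

End Parity.

Lemma has_sum_combined_split (l l0 l1 : C) :
  has_sum combined_term l ->
  has_sum (combined_term \o with_parity 0) l0 ->
  has_sum (combined_term \o with_parity 1) l1 -> l = l0 + l1.
Proof.
move=> hl h0 h1; apply: (has_sum_unique hl).
pose f (b : bool) (x : idx) := if odd x.1.2 == b then combined_term x else 0.
have fE x : f false x + f true x = combined_term x.
  by rewrite /f; case: (odd _); rewrite ?addr0 ?add0r.
apply: (eq_has_sum fE).
have hf (b : bool) (l' : C) : has_sum (combined_term \o with_parity b) l' -> has_sum (f b) l'.
  have hK : cancel (with_parity b) (fun x : idx => ((x.1.1, x.1.2./2), x.2)).
    by move=> [[t e] n1]; rewrite /with_parity/= addnC half_bit_double.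
  move=> h; rewrite -(has_sum_reindex _ hK) => [|[[t e] n1]].
    apply: (eq_has_sum _ h) => x; rewrite /f /with_parity /= oddD odd_double /=.
    by case: (b); rewrite eqxx.
  rewrite /f /with_parity/=; case: (eqVneq (odd e) b) => [<- _|_]; last by rewrite eqxx.
  by congr (_, _, _); rewrite addnC odd_double_half.
apply: has_sumD; exact: hf.
Qed.

End NahmTerm.

(** * Rewriting the product prefactors to base [q^4] *)

Section Products.
Variables (R : realType) (q : R[i]) (k : nat).
Hypotheses (q0 : q != 0) (q1 : `|q| < 1).
Local Notation Q := (q ^+ 2).

Let Q1 : `|Q| < 1 := normrX2_lt1 q1.
Let Q21 : `|Q ^+ 2| < 1 := normrX2_lt1 Q1.

Lemma qpochs_inf3 (a b c p : R[i]) :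
  qpochs_inf [:: a; b; c] p = qpoch_inf a p * qpoch_inf b p * qpoch_inf c p.
Proof. by rewrite /qpochs_inf !big_cons big_nil mulr1 mulrA. Qed.

(** [(-q;Q)_oo = (Q;Q^2)_oo / (q;Q)_oo]; splitting [(q;Q)_oo] and [(Q;Q)_oo] by parity of the index
    then cancels [(Q;Q^2)_oo]. *)
Lemma even_prefactor :
  qpoch_inf (- q) Q / qpoch_inf Q Q = (qpochs_inf [:: q; q ^+ 3; q ^+ 4] (q ^+ 4))^-1.
Proof.
have -> : q ^+ 4 = Q ^+ 2 by rewrite -exprM.
have -> : q ^+ 3 = q * Q by rewrite -exprS.
rewrite qpochs_inf3.
have n1 := qpoch_inf_neq0 Q1 q1; have n2 := qpoch_inf_neq0 Q21 Q21.
have n3 : qpoch_inf (- q) Q != 0 by apply: qpoch_inf_neq0; rewrite ?normrN.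
move: n1 n2 n3 (qpoch_inf_sqr q Q1) (qpoch_inf_double q Q1) (qpoch_inf_double Q Q1).
rewrite -[Q * Q]expr2; move: (qpoch_inf q Q) (qpoch_inf (- q) Q) (qpoch_inf Q Q)
  (qpoch_inf Q (Q ^+ 2)) (qpoch_inf q (Q ^+ 2)) (qpoch_inf (q * Q) _) (qpoch_inf (Q ^+ 2) _).
move=> x x' b y x1 x2 w x0 w0 x'0 h1 h2 ->; rewrite -h2 -h1.
by field; rewrite x0 w0 x'0.
Qed.

(** Here [(-Q;Q)_oo = (Q^2;Q^2)_oo / (Q;Q)_oo], and the denominator [(Q;Q)_oo^2] equals
    [(Q;Q^2)_oo^2 (Q^2;Q^2)_oo^2]. *)
Lemma odd_prefactor :
  qpoch_inf (- Q) Q / qpoch_inf Q Q = (qpochs_inf [:: Q; Q; q ^+ 4] (q ^+ 4))^-1.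
Proof.
have -> : q ^+ 4 = Q ^+ 2 by rewrite -exprM.
rewrite qpochs_inf3.
have n1 := qpoch_inf_neq0 Q21 Q1; have n2 := qpoch_inf_neq0 Q21 Q21.
move: n1 n2 (qpoch_inf_sqr Q Q1) (qpoch_inf_double Q Q1).
rewrite -[Q * Q]expr2; move: (qpoch_inf (- Q) Q) (qpoch_inf Q Q)
  (qpoch_inf Q (Q ^+ 2)) (qpoch_inf (Q ^+ 2) _).
move=> x' x y w y0 w0 h1 h2.
have x0 : x != 0 by rewrite h2 mulf_neq0.
have -> : x' = w / x by rewrite -h1 mulrC mulKf.
by rewrite h2; field; rewrite y0 w0.
Qed.

End Products.

(** * Matching the two parity classes with [g2] *)

Section Assembly.
Variables (R : realType) (tau : R[i]) (k : nat).
Hypothesis tau0 : 0 < complex.Im tau.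
Hypothesis k0 : (0 < k)%N.
Local Notation qp := (qpow tau).
Local Notation q := (qpow tau 1).
Local Notation Q := (q ^+ 2).
Local Notation r := k.+2.
Let q1 : `|q| < 1 := normr_qpow1_lt1 tau0.

Lemma has_sum_even (l : R[i]) :
  has_sum (combined_term tau (k := k) \o with_parity 0) l ->
  l = qp (nahm_c r) *
   (qpochs_inf [:: q ^+ (8 * k.+1); q ^+ (8 * k.+1 + 12); q ^+ (16 * k.+1 + 12)]
     (q ^+ (16 * k.+1 + 12))
    / qpochs_inf [:: q; q ^+ 3; q ^+ 4] (q ^+ 4)).
Proof.
move=> /(has_sum_parity tau0 (s := 0) (d := 2) erefl isT k0) ->.
rewrite mulr0 addr0; move: (qp (nahm_c r)) => c.
rewrite /pair_base -even_prefactor// qpochs_inf3 expr0 expr1 invr1 mulr1; cbv zeta.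
have -> : Q ^+ (2 * 2 * (2 - 1) * k.+1) * q ^+ 12 = q ^+ (8 * k.+1 + 12).
  by rewrite -exprM -exprD; congr (_ ^+ _); lia.
have -> : Q ^+ (2 * 2 * k.+1) = q ^+ (8 * k.+1).
  by rewrite -exprM; congr (_ ^+ _); lia.
have -> : q ^+ (8 * k.+1) * q ^+ (8 * k.+1 + 12) = q ^+ (16 * k.+1 + 12).
  by rewrite -exprD; congr (_ ^+ _); lia.
by rewrite -[LHS]mulrA; congr (_ * _); exact: mulrCA.
Qed.

Lemma has_sum_odd (l : R[i]) :
  has_sum (combined_term tau (k := k) \o with_parity 1) l ->
  l = qp (nahm_c r + k.+1%:R / 2 - 1) *
   (qpochs_inf [:: - q ^+ 3; q ^+ (4 * k.+1); - q ^+ (4 * k.+1 + 3)] (- q ^+ (4 * k.+1 + 3))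
    / qpochs_inf [:: q ^+ 2; q ^+ 2; q ^+ 4] (q ^+ 4)).
Proof.
move=> /(has_sum_parity tau0 (s := 1) (d := 1) erefl isT k0) ->.
rewrite mulr1 [qp (_ - 1)]qpowD qpowN; move: (qp (_ + _)) => c.
rewrite /pair_base -odd_prefactor// qpochs_inf3 expr1; cbv zeta.
have -> : Q ^+ (2 * 1 * k.+1) = q ^+ (4 * k.+1).
  by rewrite -exprM; congr (_ ^+ _); lia.
have -> : Q ^+ (2 * 1 * (1 - 1) * k.+1) * (- q ^+ 3) = - q ^+ 3.
  by rewrite subnn muln0 mul0n expr0 mul1r.
have -> : q ^+ (4 * k.+1) * (- q ^+ 3) = - q ^+ (4 * k.+1 + 3).
  by rewrite mulrN -exprD.
rewrite -[LHS]mulrA [qpoch_inf (- q ^+ 3) _ * _]mulrC.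
by congr (_ * _); exact: mulrCA.
Qed.

(** The prefactor of the odd half is the one displayed in [g2]: [(r-1)/2] comes from completing the
    square and [-1] from the factor [(q^s)^-1]. *)
Lemma nahm_ct_split : nahm_ct r = nahm_c r + k.+1%:R / 2 - 1.
Proof.
rewrite /nahm_ct /nahm_c.
have : (32 * r%:R - 8 : rat) != 0.
  by rewrite gt_eqF// subr_gt0 -[r%:R]natr1 -natr1; have : 0 <= k%:R :> rat by []; lra.
rewrite -![k.+2%:R]natr1 -![k.+1%:R]natr1; move: (k%:R) => x h; field.
by move: h; apply: contra => /eqP h; apply/eqP; rewrite -h; ring.
Qed.

End Assembly.

Theorem proposition1p9 (R : realType) (r : nat) (tau : R[i]) :
  (3 <= r)%N -> 0 < complex.Im tau ->
  g2 r tau =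
    nahm_sum (nahmA r) (nahm_b r) (nahm_c r) (nahm_d r) tau +
    nahm_sum (nahmA r) (nahm_bt r) (nahm_ct r) (nahm_d r) tau.
Proof.
case: r => [//|[//|k]] k0 tau0; have {}k0 : (0 < k)%N by [].
have [cs hc] := has_sum_combined k tau0.
have parity_abs (b : bool) : abs_summable (combined_term tau (k := k) \o with_parity b).
  apply: (abs_summable_comp (g := fun x => ((x.1.1, x.1.2./2), x.2)) _ cs).
  by move=> [[t e] n1]; rewrite /with_parity/= addnC half_bit_double.
have [l0 h0] := abs_summable_has_sum (parity_abs false).
have [l1 h1] := abs_summable_has_sum (parity_abs true).
rewrite (has_sum_combined_split hc h0 h1).
rewrite (has_sum_even tau0 k0 h0) (has_sum_odd tau0 k0 h1) -nahm_ct_split.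
have qE (x : rat) (n : nat) : x = n%:R -> qpow tau x = qpow tau 1 ^+ n.
  by move=> ->; exact: qpow_nat.
rewrite /g2.
have -> : qpow tau (8 * k.+2%:R - 8) = qpow tau 1 ^+ (8 * k.+1).
  by apply: qE; rewrite natrM -[k.+2%:R]natr1; ring.
have -> : qpow tau (8 * k.+2%:R + 4) = qpow tau 1 ^+ (8 * k.+1 + 12).
  by apply: qE; rewrite natrD natrM -[k.+2%:R]natr1; ring.
have -> : qpow tau (16 * k.+2%:R - 4) = qpow tau 1 ^+ (16 * k.+1 + 12).
  by apply: qE; rewrite natrD natrM -[k.+2%:R]natr1; ring.
have -> : qpow tau (4 * k.+2%:R - 4) = qpow tau 1 ^+ (4 * k.+1).
  by apply: qE; rewrite natrM -[k.+2%:R]natr1; ring.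
have -> : qpow tau (4 * k.+2%:R - 1) = qpow tau 1 ^+ (4 * k.+1 + 3).
  by apply: qE; rewrite natrD natrM -[k.+2%:R]natr1; ring.
rewrite (qE 2 2%N)// (qE 3 3%N)// (qE 4 4%N)// -/(nahm_ct k.+2).
(* The overall power in [g2] is that of the odd half; the inner [q^((3-r)/2)] restores the constant
   [nahm_c] of the even half. *)
have -> : nahm_c k.+2 = nahm_ct k.+2 + (3 - k.+2%:R) / 2.
  rewrite nahm_ct_split; move: (nahm_c _) => c.
  by rewrite -[k.+2%:R]natr1; field.
by rewrite qpowD mulrDr mulrA.
Qed.
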